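(* (Working in $\mathsf{ZFC}$.) If $K$ is a locally indicable group, then there exists a group $G$ containing $K$ as a subgroup such that $G$ is simple, locally indicable, strongly bounded, and $|G|=|K|^{\aleph_0}$.
   Context: A group is locally indicable if every nontrivial finitely generated subgroup admits a nontrivial homomorphism to $\mathbb{Z}$. A group $G$ is strongly bounded if whenever $G$ acts by isometries on a metric space, every orbit is bounded.
   Formalization: K is assumed nontrivial: for K trivial, |G| = |K|^{aleph_0} = 1 would force G to be trivial, and the trivial group is not simple. *)

(* Defs.v *)
From Stdlib Require Import Reals ZArith List.

Record Group : Type := MkGroup {
  carrier :> Type;
  mul : carrier -> carrier -> carrier;
  one : carrier;
  inv : carrier -> carrier;
  mul_assoc : forall x y z, mul x (mul y z) = mul (mul x y) z;
  mul_1l : forall x, mul one x = x;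
  mul_Vl : forall x, mul (inv x) x = one
}.

Arguments mul {g} x y.
Arguments one {g}.
Arguments inv {g} x.

Definition is_subgroup (G : Group) (H : G -> Prop) : Prop :=
  H one /\ (forall x y, H x -> H y -> H (mul x y)) /\ (forall x, H x -> H (inv x)).

Definition generated (G : Group) (S : list G) (x : G) : Prop :=
  forall H : G -> Prop, is_subgroup G H -> (forall s, In s S -> H s) -> H x.

Definition finitely_generated (G : Group) (H : G -> Prop) : Prop :=
  exists S : list G, forall x, H x <-> generated G S x.

Definition nontrivial_subset (G : Group) (H : G -> Prop) : Prop :=
  exists x, H x /\ x <> one.

Definition has_nontrivial_hom_to_Z (G : Group) (H : G -> Prop) : Prop :=
  exists f : G -> Z,
    (forall x y, H x -> H y -> f (mul x y) = (f x + f y)%Z) /\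
    (exists x, H x /\ f x <> 0%Z).

Definition locally_indicable (G : Group) : Prop :=
  forall H : G -> Prop, is_subgroup G H -> finitely_generated G H ->
    nontrivial_subset G H -> has_nontrivial_hom_to_Z G H.

Definition is_normal_subgroup (G : Group) (N : G -> Prop) : Prop :=
  is_subgroup G N /\ forall g x, N x -> N (mul (mul g x) (inv g)).

Definition simple_group (G : Group) : Prop :=
  (exists x : G, x <> one) /\
  forall N : G -> Prop, is_normal_subgroup G N ->
    (forall x, N x -> x = one) \/ (forall x, N x).

Definition is_metric (X : Type) (d : X -> X -> R) : Prop :=
  (forall x y, (0 <= d x y)%R) /\
  (forall x y, d x y = 0%R <-> x = y) /\
  (forall x y, d x y = d y x) /\
  (forall x y z, (d x z <= d x y + d y z)%R).

Definition isometric_action (G : Group) (X : Type) (d : X -> X -> R)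
    (act : G -> X -> X) : Prop :=
  (forall x, act one x = x) /\
  (forall g h x, act (mul g h) x = act g (act h x)) /\
  (forall g x y, d (act g x) (act g y) = d x y).

Definition strongly_bounded (G : Group) : Prop :=
  forall (X : Type) (d : X -> X -> R) (act : G -> X -> X),
    is_metric X d -> isometric_action G X d act ->
    forall x : X, exists M : R, forall g : G, (d x (act g x) <= M)%R.

Definition embeds (K G : Group) : Prop :=
  exists f : K -> G,
    (forall x y, f (mul x y) = mul (f x) (f y)) /\
    (forall x y, f x = f y -> x = y).

Definition equipotent (A B : Type) : Prop :=
  exists (f : A -> B) (g : B -> A),
    (forall a, g (f a) = a) /\ (forall b, f (g b) = b).

(* Main.v *)
Require Import Defs.
From Stdlib Require Import Reals ZArith List Cantor Lra Lia ssreflect.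
From Stdlib Require Import Classical ClassicalEpsilon FunctionalExtensionality.
From Stdlib Require Import PropExtensionality ProofIrrelevance.
From mathcomp Require filter.

(** Let [Omega] be the set of finitely supported functions from an ordered set of levels to
[K], seen as the branches of a tree whose nodes are the initial segments of branches. The group
[M] of tame permutations consists of tree-like permutations of [Omega] which, along every
branch, change finitely many letters by left translations in [K] and reparametrize the levels
by a piecewise affine map with slopes in [2 ^ Z], and which are supported in a cylinder around
the trivial branch.

Given finitely many elements of [M] and a branch that one of them moves, look at the first
level of this branch where one of them acts nontrivially: there the letter and the slope
exponent define a homomorphism to [K * Z], so [M] is locally indicable.

Writing [g] as a commutator of a wreath-type element and of a letter shift (Neumann and
Neumann), every [b] is a commutator, and dilations conjugate the support of [b] into a cylinder
displaced by a given [a <> one]; hence [b] is an explicit product of conjugates of [a] and of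
its inverse. Since countably many levels have a common lower bound, every sequence in [M]
consists of words of prescribed lengths in two elements, which bounds all orbits.

These two properties are preserved by a subgroup closed under suitable Skolem functions of
countable arity, and the closure of a copy of [nat -> K] has the required cardinality. *)

(** * A free ultrafilter on [nat] *)

Lemma free_ultrafilter : exists U : (nat -> Prop) -> Prop,
  (forall P Q : nat -> Prop, U P -> U Q -> U (fun n => P n /\ Q n)) /\
  (forall P Q : nat -> Prop, (forall n, P n -> Q n) -> U P -> U Q) /\
  (forall P : nat -> Prop, U P \/ U (fun n => ~ P n)) /\
  ~ U (fun _ => False) /\
  (forall N, U (fun n => N <= n)).
Proof.
(* The Fréchet filter of cofinite sets; any ultrafilter extending it is free. *)
pose F (P : nat -> Prop) := exists N, forall n, N <= n -> P n.
have FF : filter.ProperFilter F.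
  split; last split.
  - by case=> N H; exact: (H N (le_n N)).
  - by exists 0.
  - move=> P Q [N HN] [M HM]; exists (N + M) => n Hn; split.
      by apply: HN; lia.
    by apply: HM; lia.
  - by move=> P Q PQ [N HN]; exists N => n Hn; apply: PQ; apply: HN.
have [U [UU FU]] := filter.ultraFilterLemma FF.
have UP := @filter.ultra_proper _ _ UU.
have UF := @filter.filter_filter _ _ UP.
exists U; split; [|split; [|split; [|split]]].
- by move=> P Q HP HQ; apply: (@filter.filterI _ _ UF).
- by move=> P Q PQ; apply: (@filter.filterS _ _ UF).
- by move=> P; exact: (filter.in_ultra_setVsetC P UU).
- exact: (@filter.filter_not_empty _ _ UP).
- by move=> N; apply: FU; exists N.
Qed.

Definition ultra : (nat -> Prop) -> Prop :=
  proj1_sig (constructive_indefinite_description _ free_ultrafilter).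

Lemma ultra_and (P Q : nat -> Prop) : ultra P -> ultra Q -> ultra (fun n => P n /\ Q n).
Proof. exact: (proj1 (proj2_sig (constructive_indefinite_description _ free_ultrafilter))). Qed.

Lemma ultra_mono (P Q : nat -> Prop) : (forall n, P n -> Q n) -> ultra P -> ultra Q.
Proof.
exact: (proj1 (proj2 (proj2_sig (constructive_indefinite_description _ free_ultrafilter)))).
Qed.

Lemma ultra_or_not (P : nat -> Prop) : ultra P \/ ultra (fun n => ~ P n).
Proof.
move: (proj2_sig (constructive_indefinite_description _ free_ultrafilter)).
by rewrite -/ultra; firstorder.
Qed.

Lemma ultra_proper : ~ ultra (fun _ => False).
Proof.
move: (proj2_sig (constructive_indefinite_description _ free_ultrafilter)).
by rewrite -/ultra; firstorder.
Qed.

Lemma ultra_ge (N : nat) : ultra (fun n => N <= n).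
Proof.
move: (proj2_sig (constructive_indefinite_description _ free_ultrafilter)).
by rewrite -/ultra; firstorder.
Qed.

Lemma ultra_all (P : nat -> Prop) : (forall n, P n) -> ultra P.
Proof. by move=> H; apply: ultra_mono (ultra_ge 0). Qed.

Lemma ultra_and_mono (P Q S : nat -> Prop) :
  (forall n, P n -> Q n -> S n) -> ultra P -> ultra Q -> ultra S.
Proof. by move=> H HP HQ; apply: ultra_mono (ultra_and _ _ HP HQ) => n [? ?]; apply: H. Qed.

Lemma ultra_ex (P : nat -> Prop) : ultra P -> exists n, P n.
Proof.
move=> HP; apply: NNPP => H; apply: ultra_proper; apply: ultra_mono HP => n Pn.
by apply: H; exists n.
Qed.

(** * Levels *)

Section Levels.
Local Open Scope R_scope.

Definition ueq (f g : nat -> R) : Prop := ultra (fun i => f i = g i).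

(** A chosen representative of the class of [f] modulo [ultra], which lets the ultrapower be a
    subtype whose equality is Leibniz equality. *)
Definition unormal (f : nat -> R) : nat -> R := epsilon (inhabits f) (ueq f).

Lemma unormal_ueq f : ueq f (unormal f).
Proof. by apply: epsilon_spec; exists f; apply: ultra_all. Qed.

Lemma unormal_eq f g : ueq f g -> unormal f = unormal g.
Proof.
move=> H; rewrite /unormal.
have -> : ueq f = ueq g.
  apply: functional_extensionality => h; apply: propositional_extensionality.
  by split; apply: (ultra_and_mono _ _ _ _ H) => i -> .
by congr epsilon; apply: proof_irrelevance.
Qed.

(* The set of levels is the ultrapower of [R]: it is totally ordered, carries the affine maps
   below, and each of its countable subsets is bounded. *)
Definition level : Type := {f : nat -> R | unormal f = f}.

Definition lclass (f : nat -> R) : level :=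
  exist _ (unormal f) (eq_sym (unormal_eq _ _ (unormal_ueq f))).

Definition lrep (l : level) : nat -> R := proj1_sig l.

Lemma lrep_lclass f : ultra (fun i => lrep (lclass f) i = f i).
Proof. by apply: ultra_mono (unormal_ueq f) => i ->. Qed.

Lemma level_eq (l m : level) : ultra (fun i => lrep l i = lrep m i) -> l = m.
Proof.
case: l m => [f Hf] [g Hg] /= /unormal_eq; rewrite Hf Hg => E.
by subst g; congr exist; apply: proof_irrelevance.
Qed.

Definition lt (l m : level) : Prop := ultra (fun i => lrep l i < lrep m i).

(* The affine map of slope [2 ^ n] sending [l] to [l']. *)
Definition aff (l l' : level) (n : Z) (m : level) : level :=
  lclass (fun i => lrep l' i + powerRZ 2 n * (lrep m i - lrep l i)).

Lemma lrep_aff l l' n m :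
  ultra (fun i => lrep (aff l l' n m) i = lrep l' i + powerRZ 2 n * (lrep m i - lrep l i)).
Proof. exact: lrep_lclass. Qed.

Lemma lt_irrefl l : ~ lt l l.
Proof. by move=> H; apply: ultra_proper; apply: ultra_mono H => i; lra. Qed.

Lemma lt_trans l m p : lt l m -> lt m p -> lt l p.
Proof. by apply: ultra_and_mono => i; lra. Qed.

Lemma lt_total l m : lt l m \/ l = m \/ lt m l.
Proof.
case: (ultra_or_not (fun i => lrep l i < lrep m i)) => [|H]; first by left.
case: (ultra_or_not (fun i => lrep m i < lrep l i)) => [|H']; first by right; right.
by right; left; apply: level_eq; apply: (ultra_and_mono _ _ _ _ H H') => i; lra.
Qed.

Lemma lt_dense l m : lt l m -> exists p, lt l p /\ lt p m.
Proof.
move=> H; pose f i := (lrep l i + lrep m i) / 2.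
exists (lclass f).
by split; apply: (ultra_and_mono _ _ _ _ H (lrep_lclass f)) => i ? ->; rewrite /f; lra.
Qed.

Lemma lt_above l : exists m, lt l m.
Proof.
pose f i := lrep l i + 1.
by exists (lclass f); apply: ultra_mono (lrep_lclass f) => i ->; rewrite /f; lra.
Qed.

(** Diagonal argument: at index [i] stay below the first [i + 1] entries. The [n]-th entry is then
    beaten at all [i >= n], a set in the free ultrafilter. *)
Lemma lt_below_seq (s : nat -> level) : exists p, forall n, lt p (s n).
Proof.
pose fix b (i n : nat) : R :=
  match n with O => lrep (s O) i | S n' => Rmin (b i n') (lrep (s n) i) end.
have bP i n k : (n <= k)%nat -> b i k <= lrep (s n) i.
  elim: k => [|k IH] Hnk.
    have -> : n = O by lia.
    by rewrite /=; lra.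
  have Hl := Rmin_l (b i k) (lrep (s (S k)) i).
  have Hr := Rmin_r (b i k) (lrep (s (S k)) i).
  have [->|Hn] : n = S k \/ (n <= k)%nat by lia.
    exact: Hr.
  by have := IH Hn; simpl; lra.
pose f i := b i i - 1.
exists (lclass f) => n.
apply: (ultra_and_mono _ _ _ _ (lrep_lclass f) (ultra_ge n)) => i -> Hi; rewrite /f.
by have := bP i n i Hi; lra.
Qed.

Lemma two_neq0 : 2 <> 0. Proof. lra. Qed.

Lemma powerRZ2_gt0 n : 0 < powerRZ 2 n.
Proof. by apply: powerRZ_lt; lra. Qed.

Lemma aff0 l m : aff l l 0 m = m.
Proof. by apply: level_eq; apply: ultra_mono (lrep_aff l l 0 m) => i -> /=; lra. Qed.

Lemma aff_base l l' n : aff l l' n l = l'.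
Proof. by apply: level_eq; apply: ultra_mono (lrep_aff l l' n l) => i ->; ring. Qed.

Lemma aff_comp l l' l'' n n' m : aff l' l'' n' (aff l l' n m) = aff l l'' (n' + n) m.
Proof.
apply: level_eq.
apply: (ultra_and_mono _ _ _ _ (lrep_aff l' l'' n' (aff l l' n m))
  (ultra_and _ _ (lrep_aff l l' n m) (lrep_aff l l'' (n' + n) m))).
move=> i /= -> [-> ->].
by rewrite powerRZ_add; [ring | exact: two_neq0].
Qed.

Lemma aff_lt l l' n m m' : lt m m' -> lt (aff l l' n m) (aff l l' n m').
Proof.
move=> H; apply: (ultra_and_mono _ _ _ _ H
  (ultra_and _ _ (lrep_aff l l' n m) (lrep_aff l l' n m'))) => i Hi [-> ->].
by have := powerRZ2_gt0 n; nra.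
Qed.

Lemma aff_rebase l l' n m p : aff m (aff l l' n m) n p = aff l l' n p.
Proof.
apply: level_eq.
apply: (ultra_and_mono _ _ _ _ (lrep_aff m (aff l l' n m) n p)
  (ultra_and _ _ (lrep_aff l l' n m) (lrep_aff l l' n p))).
by move=> i /= -> [-> ->]; ring.
Qed.

Lemma powerRZ2_gt1 n : (0 < n)%Z -> 1 < powerRZ 2 n.
Proof.
case: n => [|p|p] // _ /=.
by apply: Rlt_pow_R1; [lra | exact: Pos2Nat.is_pos].
Qed.

Lemma powerRZ2_eq1 n : powerRZ 2 n = 1 -> n = 0%Z.
Proof.
move=> H; have [|[//|Hn]] : (0 < n)%Z \/ n = 0%Z \/ (0 < - n)%Z by lia.
  by move/powerRZ2_gt1; lra.
have := powerRZ2_gt1 _ Hn.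
have : powerRZ 2 (n + - n) = powerRZ 2 n * powerRZ 2 (- n).
  by apply: powerRZ_add; exact: two_neq0.
by rewrite Z.add_opp_diag_r H /=; lra.
Qed.

(** An affine map with two fixed points has slope one; this is what makes slope exponents well
    defined. *)
Lemma aff_inj l n m : lt l m -> aff l l n m = m -> n = 0%Z.
Proof.
move=> H E.
have H2 := lrep_aff l l n m.
have [i [Hi Ei]] := ultra_ex _ (ultra_and _ _ H H2).
rewrite E in Ei.
by apply: powerRZ2_eq1; nra.
Qed.

Lemma aff_move l m : lt l m -> exists p, lt p l /\ aff p p 1 l = m.
Proof.
(* The solution of [p + 2 * (l - p) = m], computed pointwise. *)
move=> H; pose f i := 2 * lrep l i - lrep m i.
exists (lclass f); split.
  by apply: (ultra_and_mono _ _ _ _ H (lrep_lclass f)) => i ? ->; rewrite /f; lra.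
apply: level_eq.
apply: (ultra_and_mono _ _ _ _ (lrep_lclass f) (lrep_aff (lclass f) (lclass f) 1 l)) => i Hi ->.
rewrite Hi.
by rewrite /f /=; lra.
Qed.
End Levels.

(** * Groups and permutations *)

Section GroupTheory.
Variable G : Group.
Implicit Types x y g : G.

Lemma mul_cancel_l g x y : mul g x = mul g y -> x = y.
Proof.
move=> H; have : mul (inv g) (mul g x) = mul (inv g) (mul g y) by rewrite H.
by rewrite !mul_assoc mul_Vl !mul_1l.
Qed.

Lemma mul_1r x : mul x one = x.
Proof. by apply: (mul_cancel_l (inv x)); rewrite mul_assoc mul_Vl mul_1l. Qed.

Lemma mul_Vr x : mul x (inv x) = one.
Proof. by apply: (mul_cancel_l (inv x)); rewrite mul_assoc mul_Vl mul_1l mul_1r. Qed.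

Lemma mul_VK x y : mul (inv x) (mul x y) = y.
Proof. by rewrite mul_assoc mul_Vl mul_1l. Qed.

Lemma mul_KV x y : mul x (mul (inv x) y) = y.
Proof. by rewrite mul_assoc mul_Vr mul_1l. Qed.

Lemma mul_cancel_r g x y : mul x g = mul y g -> x = y.
Proof.
move=> H; have : mul (mul x g) (inv g) = mul (mul y g) (inv g) by rewrite H.
by rewrite -!mul_assoc mul_Vr !mul_1r.
Qed.

Lemma inv_uniq x y : mul x y = one -> y = inv x.
Proof. by move=> H; apply: (mul_cancel_l x); rewrite H mul_Vr. Qed.

Lemma inv_mul x y : inv (mul x y) = mul (inv y) (inv x).
Proof. by symmetry; apply: inv_uniq; rewrite -mul_assoc mul_KV mul_Vr. Qed.

Lemma inv_inv x : inv (inv x) = x.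
Proof. by symmetry; apply: inv_uniq; rewrite mul_Vl. Qed.

Lemma inv_one : inv (one : G) = one.
Proof. by symmetry; apply: inv_uniq; rewrite mul_1l. Qed.

Lemma mul_eq_self x y : mul x y = y -> x = one.
Proof. by move=> H; apply: (mul_cancel_r y); rewrite mul_1l. Qed.

Fixpoint powg x (n : nat) : G := match n with O => one | S n => mul x (powg x n) end.

Lemma pow_add x m n : powg x (m + n) = mul (powg x m) (powg x n).
Proof. by elim: m => [|m IH] /=; rewrite ?mul_1l // IH mul_assoc. Qed.

Definition conjg g x : G := mul (mul g x) (inv g).

Definition commg x y : G := mul (mul x y) (mul (inv x) (inv y)).

Lemma comm_conj_inv x y : commg x y = mul x (conjg y (inv x)).
Proof. by rewrite /commg /conjg !mul_assoc. Qed.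

Lemma comm_mul_l x y g : mul y g = mul g y -> commg (mul x y) g = commg x g.
Proof.
move=> H; rewrite /commg inv_mul -!mul_assoc; congr mul.
by rewrite mul_assoc H -mul_assoc; congr mul; rewrite mul_KV.
Qed.

Lemma conj_mul g x y : conjg g (mul x y) = mul (conjg g x) (conjg g y).
Proof. by rewrite /conjg -!mul_assoc mul_VK. Qed.

Lemma conj_inv g x : conjg g (inv x) = inv (conjg g x).
Proof. by rewrite /conjg !inv_mul inv_inv mul_assoc. Qed.

Lemma conj_comm g x y : conjg g (commg x y) = commg (conjg g x) (conjg g y).
Proof. by rewrite /commg !conj_mul !conj_inv. Qed.

Lemma conj_VK g x : conjg (inv g) (conjg g x) = x.
Proof. by rewrite /conjg inv_inv -!mul_assoc mul_VK mul_Vl mul_1r. Qed.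

Lemma subgroup_conj (H : G -> Prop) g x : is_subgroup G H -> H g -> H x -> H (conjg g x).
Proof. by case=> _ [HM HV] Hg Hx; apply: (HM _ _ (HM _ _ Hg Hx) (HV _ Hg)). Qed.

Lemma subgroup_pow (H : G -> Prop) x n : is_subgroup G H -> H x -> H (powg x n).
Proof. by case=> H1 [HM _] Hx; elim: n => //= n IH; apply: HM. Qed.

Section Subgroup.
Variables (H : G -> Prop) (sgH : is_subgroup G H).

Let T := {x : G | H x}.

Lemma sub_ext (a b : T) : proj1_sig a = proj1_sig b -> a = b.
Proof. by case: a b => [a Ha] [b Hb] /= E; subst b; rewrite (proof_irrelevance _ Ha Hb). Qed.

Definition subgroup_group : Group.
Proof.
refine (@MkGroup T
  (fun a b => exist _ (mul (proj1_sig a) (proj1_sig b))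
     (proj1 (proj2 sgH) _ _ (proj2_sig a) (proj2_sig b)))
  (exist _ one (proj1 sgH))
  (fun a => exist _ (inv (proj1_sig a)) (proj2 (proj2 sgH) _ (proj2_sig a))) _ _ _).
- by move=> x y w; apply: sub_ext; rewrite /= mul_assoc.
- by move=> x; apply: sub_ext; rewrite /= mul_1l.
- by move=> x; apply: sub_ext; rewrite /= mul_Vl.
Defined.
End Subgroup.

End GroupTheory.

Arguments powg {G}.
Arguments conjg {G}.
Arguments commg {G}.

(** The image of [H] under [phi] is a nontrivial finitely generated subgroup of [K]; [phi] is
    composed with a map from this image to [Z]. *)
Lemma hom_to_locally_indicable (G K : Group) (H : G -> Prop) (phi : G -> K) :
  locally_indicable K -> is_subgroup G H -> finitely_generated G H ->
  (forall x y, H x -> H y -> phi (mul x y) = mul (phi x) (phi y)) ->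
  (exists x, H x /\ phi x <> one) -> has_nontrivial_hom_to_Z G H.
Proof.
move=> LI sgH [T HT] phiM [x0 [Hx0 Nx0]].
have [H1 [HM HV]] := sgH.
have phi1 : phi one = one.
  by apply: (mul_eq_self _ _ (phi one)); rewrite -phiM // mul_1l.
have phiV x : H x -> phi (inv x) = inv (phi x).
  by move=> Hx; apply: inv_uniq; rewrite -phiM ?mul_Vr //; exact: HV.
pose I k := exists x, H x /\ phi x = k.
have sgI : is_subgroup K I.
  split; first by exists one.
  split.
    by move=> _ _ [x [Hx <-]] [y [Hy <-]]; exists (mul x y); rewrite phiM //; split=> //; exact: HM.
  by move=> _ [x [Hx <-]]; exists (inv x); rewrite phiV //; split=> //; exact: HV.
have HinT s : In s T -> H s by move=> Hs; apply/HT => P _; apply.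
have [||f [fM [_ [[x [Hx <-]] Nf]]]] := LI I sgI.
- exists (map phi T) => k; split.
    move=> [x [Hx <-]] P sgP HP.
    have [P1 [PM PV]] := sgP.
    apply: (proj2 (proj1 (HT x) Hx (fun x => H x /\ P (phi x)) _ _)).
      split; first by rewrite phi1.
      split; first by move=> a b [Ha Pa] [Hb Pb]; split; [exact: HM | rewrite phiM //; exact: PM].
      by move=> a [Ha Pa]; split; [exact: HV | rewrite phiV //; exact: PV].
    by move=> s Hs; split; [exact: HinT | apply: HP; exact: in_map].
  move/(_ I sgI); apply=> k' /in_map_iff [s [<- Hs]].
  by exists s; split=> //; exact: HinT.
- by exists (phi x0); split=> //; exists x0.
exists (fun y => f (phi y)); split; last by exists x.
by move=> y w Hy Hw; rewrite phiM // fM //; [exists y | exists w].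
Qed.

Record perm (X : Type) : Type := MkPerm {
  pfun :> X -> X;
  pinv : X -> X;
  pfunK : forall x, pinv (pfun x) = x;
  pinvK : forall x, pfun (pinv x) = x
}.
Arguments pinv {X}.

Lemma perm_inj X (s : perm X) x y : s x = s y -> x = y.
Proof. by move=> H; rewrite -(pfunK _ s x) H pfunK. Qed.

Lemma perm_ext X (s t : perm X) : (forall x, s x = t x) -> s = t.
Proof.
move=> H; have Ef : pfun _ s = pfun _ t by apply: functional_extensionality.
have Ei : pinv s = pinv t.
  apply: functional_extensionality => x.
  by apply: (perm_inj _ t); rewrite -H !pinvK.
case: s t Ef Ei {H} => [f g fK gK] [f' g' fK' gK'] /= Ef Ei; subst f' g'.
by rewrite (proof_irrelevance _ fK fK') (proof_irrelevance _ gK gK').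
Qed.

Definition perm_group (X : Type) : Group.
Proof.
unshelve refine (@MkGroup (perm X)
  (fun s t => MkPerm X (fun x => s (t x)) (fun x => pinv t (pinv s x)) _ _)
  (MkPerm X (fun x => x) (fun x => x) (fun _ => eq_refl) (fun _ => eq_refl))
  (fun s => MkPerm X (pinv s) s (pinvK _ s) (pfunK _ s)) _ _ _).
- by move=> x; rewrite !pfunK.
- by move=> x; rewrite !pinvK.
- by move=> s t u; apply: perm_ext.
- by move=> s; apply: perm_ext.
- by move=> s; apply: perm_ext => x; rewrite /= pfunK.
Defined.

(** * Tame permutations *)

Section Tracks.
Variable K : Group.

Definition omega : Type :=
  {x : level -> K | exists s : list level, forall l, ~ In l s -> x l = one}.

Definition coord (x : omega) : level -> K := proj1_sig x.
Coercion coord : omega >-> Funclass.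

Lemma omega_ext (x y : omega) : (forall l, x l = y l) -> x = y.
Proof.
case: x y => [x Hx] [y Hy] /= H.
have E : x = y by apply: functional_extensionality.
by subst y; rewrite (proof_irrelevance _ Hx Hy).
Qed.

Definition base : omega := exist _ (fun _ => one) (ex_intro _ nil (fun _ _ => eq_refl)).

Definition upd_fun (x : level -> K) (l : level) (k : K) (m : level) : K :=
  if excluded_middle_informative (m = l) is left _ then k else x m.

Lemma upd_finite (x : omega) l k :
  exists s : list level, forall m, ~ In m s -> upd_fun x l k m = one.
Proof.
case: (proj2_sig x) => s Hs; exists (l :: s) => m Hm; rewrite /upd_fun.
case: excluded_middle_informative => [E|_].
  by case: Hm; left.
by apply: Hs => H; apply: Hm; right.
Qed.

Definition upd (x : omega) l k : omega := exist _ (upd_fun x l k) (upd_finite x l k).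

Lemma upd_same (x : omega) l k : upd x l k l = k.
Proof. by rewrite /= /upd_fun; case: excluded_middle_informative. Qed.

Lemma upd_other (x : omega) l k m : m <> l -> upd x l k m = x m.
Proof. by rewrite /= /upd_fun; case: excluded_middle_informative. Qed.

Lemma upd_upd (x : omega) l k k' : upd (upd x l k) l k' = upd x l k'.
Proof.
apply: omega_ext => m; case: (classic (m = l)) => [->|H].
  by rewrite !upd_same.
by rewrite !upd_other.
Qed.

Lemma upd_id (x : omega) l k : x l = k -> upd x l k = x.
Proof.
move=> E; apply: omega_ext => m; case: (classic (m = l)) => [->|H].
  by rewrite upd_same.
by rewrite upd_other.
Qed.

(** The classes of [agree l] are the nodes of the tree at level [l]; the letter at [l] is not part
    of the node. *)
Definition agree (l : level) (x y : omega) : Prop := forall m, lt m l -> x m = y m.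

Lemma agree_refl l x : agree l x x. Proof. by []. Qed.

Lemma agree_sym l x y : agree l x y -> agree l y x.
Proof. by move=> H m /H. Qed.

Lemma agree_trans l x y w : agree l x y -> agree l y w -> agree l x w.
Proof. by move=> H H' m Hm; rewrite H // H'. Qed.

Lemma agree_lt l l' x y : lt l l' -> agree l' x y -> agree l x y.
Proof. by move=> H H' m Hm; apply: H'; apply: lt_trans H. Qed.

Lemma lt_neq l m : lt l m -> l <> m.
Proof. by move=> H E; subst m; case: (lt_irrefl l). Qed.

Lemma lt_asym l m : lt l m -> ~ lt m l.
Proof. by move=> H H'; case: (lt_irrefl l); apply: lt_trans H'. Qed.

Lemma agree_upd l (x : omega) m k : ~ lt m l -> agree l x (upd x m k).
Proof. by move=> H p Hp; rewrite upd_other // => E; subst p. Qed.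

(** * Arrows and tracks along a branch *)

Notation Sym := (perm_group omega).

(* [s] maps the cylinder of points agreeing with [x] below [l] onto the one of [s x] below
   [l'], multiplies the coordinate at [l] by [k], and dilates the levels immediately above [l]
   by [2 ^ n]. *)
Definition arrow (s : Sym) (x : omega) (l l' : level) (k : K) (n : Z) : Prop :=
  (forall y, agree l x y <-> agree l' (s x) (s y)) /\
  (forall y, agree l x y -> s y l' = mul k (y l)) /\
  exists e, lt l e /\ forall y, agree l x y ->
    forall m, lt l m -> lt m e -> s y (aff l l' n m) = y m.

Lemma arrow_agree s x x' l l' k n : agree l x x' -> arrow s x l l' k n -> arrow s x' l l' k n.
Proof.
move=> Hx [H1 [H2 [e [He H3]]]]; split; last split.
- move=> y; split.
    move=> H; apply: agree_trans (proj1 (H1 y) (agree_trans _ _ _ _ Hx H)).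
    by apply: agree_sym; apply/H1.
  move=> H; apply: (agree_trans _ _ x); first exact: agree_sym.
  by apply/H1; apply: agree_trans H; apply/H1.
- by move=> y H; apply: H2; apply: agree_trans H.
- by exists e; split=> // y H; apply: H3; apply: agree_trans H.
Qed.

Lemma lt_min l m : exists p, (p = l \/ p = m) /\ (forall q, lt q p -> lt q l /\ lt q m).
Proof.
case: (lt_total l m) => [H|[<-|H]].
- by exists l; split; [left | move=> q Hq; split=> //; apply: lt_trans H].
- by exists l; split; [left|].
- by exists m; split; [right | move=> q Hq; split=> //; apply: lt_trans H].
Qed.

Lemma aff_inv l l' n m : aff l' l (- n) (aff l l' n m) = m.
Proof. by rewrite aff_comp Z.add_opp_diag_l aff0. Qed.

Lemma aff_gt l l' n m : lt l m -> lt l' (aff l l' n m).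
Proof. by move=> H; rewrite -{1}(aff_base l l' n); apply: aff_lt. Qed.

Lemma arrow_mul s t x l l' l'' k k' n n' :
  arrow t x l l' k n -> arrow s (t x) l' l'' k' n' ->
  arrow (mul s t) x l l'' (mul k' k) (n' + n).
Proof.
move=> [H1 [H2 [e [He H3]]]] [J1 [J2 [d [Hd J3]]]]; split; last split.
- by move=> y; rewrite H1 J1.
- by move=> y H; rewrite /= J2 ?H2 ?mul_assoc //; apply/H1.
(* The affine formulas compose at levels below [e] whose image lies below [d]. *)
- have [p [Hp Hpq]] := lt_min e (aff l' l (- n) d).
  exists p; split.
    by case: Hp => -> //; apply: aff_gt.
  move=> y H m Hm /Hpq [He' Hd'] /=.
  rewrite -(aff_comp l l' l'' n n') J3 ?H3 //; first by apply/H1.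
    exact: aff_gt.
  have := aff_lt l l' n _ _ Hd'.
  by rewrite aff_comp Z.add_opp_diag_r aff0.
Qed.

Lemma arrow_inv s x l l' k n :
  arrow s x l l' k n -> arrow (inv s) (s x) l' l (inv k) (- n).
Proof.
move=> [H1 [H2 [e [He H3]]]].
have E y : agree l' (s x) y -> agree l x (pinv s y).
  by move=> H; apply/H1; rewrite pinvK.
split; last split.
- move=> y /=; rewrite pfunK; split; first exact: E.
  by move=> /H1; rewrite pinvK.
- by move=> y /E /H2 /=; rewrite pinvK => ->; rewrite mul_VK.
- exists (aff l l' n e); split; first exact: aff_gt.
  move=> y /E H m Hm Hme /=.
  have := H3 _ H (aff l' l (- n) m) (aff_gt _ _ _ _ Hm).
  rewrite aff_comp Z.add_opp_diag_r aff0 pinvK => -> //.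
  have := aff_lt l' l (- n) _ _ Hme.
  by rewrite aff_inv.
Qed.

Lemma arrow_fix (s : Sym) x l : (forall y, agree l x y -> s y = y) -> arrow s x l l one 0.
Proof.
move=> H; split; last split.
- move=> y; rewrite (H x) //; split=> Hy; first by rewrite H.
  by rewrite -(perm_inj _ _ _ _ (H _ Hy)).
- by move=> y Hy; rewrite H ?mul_1l.
- have [e He] := lt_above l; exists e; split=> // y Hy m _ _.
  by rewrite aff0 H.
Qed.

Lemma arrow_low (s : Sym) v x l :
  (forall y, agree v y (s y)) -> lt l v -> arrow s x l l one 0.
Proof.
move=> H Hl; split; last split.
- move=> y; have Hx := agree_lt _ _ _ _ Hl (H x); have Hy := agree_lt _ _ _ _ Hl (H y).
  split=> A; first exact: agree_trans (agree_sym _ _ _ Hx) (agree_trans _ _ _ _ A Hy).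
  exact: agree_trans Hx (agree_trans _ _ _ _ A (agree_sym _ _ _ Hy)).
- by move=> y _; rewrite mul_1l -(H y).
- by exists v; split=> // y _ m _ Hm; rewrite aff0 -(H y).
Qed.

(** As [K] is nontrivial, changing a single letter of a branch gives test points. A change at the
    lower of two candidate targets keeps the node at that level but alters the node at the higher
    one; a change just above [l] separates two exponents. *)
Lemma arrow_unique s x l l1 k1 n1 l2 k2 n2 : (exists z : K, z <> one) ->
  arrow s x l l1 k1 n1 -> arrow s x l l2 k2 n2 -> l1 = l2 /\ k1 = k2 /\ n1 = n2.
Proof.
case=> z Hz A B.
have Hne (y : omega) m : mul z (y m) <> y m by move/mul_eq_self.
have Hlt l1' l2' k1' k2' n1' n2' : arrow s x l l1' k1' n1' -> arrow s x l l2' k2' n2' ->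
    ~ lt l1' l2'.
  move=> [H1 _] [J1 _] H.
  pose u := upd (s x) l1' (mul z (s x l1')).
  have Hu : agree l1' (s x) (s (pinv s u)).
    by rewrite pinvK; apply: agree_upd; apply: lt_irrefl.
  move: Hu => /H1 /J1; rewrite pinvK => /(_ _ H).
  by rewrite upd_same => E; apply: (Hne (s x) l1').
have E : l1 = l2.
  case: (lt_total l1 l2) => [/(Hlt _ _ _ _ _ _ A B)|[//|/(Hlt _ _ _ _ _ _ B A)]] //.
subst l2; split=> //.
case: A B => [_ [A2 [e [He A3]]]] [_ [B2 [d [Hd B3]]]]; split.
  apply: (mul_cancel_r _ (x l)).
  by rewrite -A2 // -B2.
have [p [Hp Hpq]] := lt_min e d.
have Hlp : lt l p by case: Hp => ->.
(* For [m] below [q], both [m] and its image under slope [2 ^ (n2 - n1)] lie below [p], where the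
   two affine formulas hold. *)
have [q [Hq Hqr]] := lt_min p (aff l l (n1 - n2) p).
have Hlq : lt l q by case: Hq => -> //; apply: aff_gt.
have [m [Hm Hmq]] := lt_dense _ _ Hlq.
have [Hmp Hmp'] := Hqr _ Hmq.
have [Hme Hmd] := Hpq _ Hmp.
pose m' := aff l l (n2 - n1) m.
have Hm' : lt m' p.
  have := aff_lt l l (n2 - n1) _ _ Hmp'; rewrite -/m' aff_comp.
  have -> : (n2 - n1 + (n1 - n2))%Z = 0%Z by lia.
  by rewrite aff0.
have Elem y : agree l x y -> y m = y m'.
  move=> Hy; rewrite -(B3 y Hy m Hm Hmd) -(A3 y Hy m').
  - congr (s y _); rewrite /m' aff_comp; congr aff; lia.
  - exact: aff_gt.
  - by case: (Hpq _ Hm').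
have Em : m' = m.
  apply: NNPP => Nm.
  pose y := upd x m (mul z (x m)).
  have Hy : agree l x y by apply: agree_upd; apply: lt_asym.
  have := Elem y Hy; rewrite /y upd_same upd_other // -(Elem x) //.
  exact: Hne.
have := aff_inj _ _ _ Hm Em; lia.
Qed.

(* [tf] is the reparametrization of the levels along the branch [x], with inverse [tg]; [tk]
   and [tn] are the letters and slope exponents, which change only at the breakpoints [tB]. *)
Record track (s : Sym) (x : omega) : Type := Track {
  tf : level -> level;
  tg : level -> level;
  tk : level -> K;
  tn : level -> Z;
  tB : list level;
  tfK : forall l, tg (tf l) = l;
  tgK : forall l, tf (tg l) = l;
  tf_lt : forall l m, lt l m -> lt (tf l) (tf m);
  t_arrow : forall l, arrow s x l (tf l) (tk l) (tn l);
  tk_off : forall l, ~ In l tB -> tk l = one;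
  tf_aff : forall l m, lt l m -> (forall b, In b tB -> lt l b -> ~ lt b m) ->
    tf m = aff l (tf l) (tn l) m;
  tn_off : forall l m, lt l m -> (forall b, In b tB -> lt l b -> lt m b) -> tn m = tn l;
  t_low : exists c, forall l, lt l c -> tf l = l /\ tk l = one /\ tn l = 0%Z
}.

Lemma tg_lt s x (d : track s x) l m : lt l m -> lt (tg _ _ d l) (tg _ _ d m).
Proof.
move=> H; case: (lt_total (tg _ _ d l) (tg _ _ d m)) => [//|[E|/(tf_lt _ _ d)]].
  by move: H; rewrite -(tgK _ _ d l) E tgK => /lt_irrefl.
by rewrite !tgK => /lt_asym.
Qed.

Lemma track_one_arrows (s : Sym) x : (forall l, arrow s x l l one 0) -> inhabited (track s x).
Proof.
move=> H; split.
refine (Track s x (fun l => l) (fun l => l) (fun _ => one)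
  (fun _ => 0%Z) nil _ _ _ H _ _ _ _) => //.
  by move=> l m _ _; rewrite aff0.
by have [c _] := lt_above (lclass (fun _ => 0%R)); exists c.
Qed.

(** Reparametrizations compose, letters multiply and exponents add; the breakpoints are those of [t]
    together with the preimages of those of [s]. *)
Lemma track_mul (s t : Sym) x :
  inhabited (track t x) -> inhabited (track s (t x)) -> inhabited (track (mul s t) x).
Proof.
case=> d [e]; split.
refine (Track (mul s t) x (fun l => tf _ _ e (tf _ _ d l)) (fun l => tg _ _ d (tg _ _ e l))
  (fun l => mul (tk _ _ e (tf _ _ d l)) (tk _ _ d l))
  (fun l => (tn _ _ e (tf _ _ d l) + tn _ _ d l)%Z)
  (tB _ _ d ++ map (tg _ _ d) (tB _ _ e)) _ _ _ _ _ _ _ _).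
- by move=> l; rewrite !tfK.
- by move=> l; rewrite !tgK.
- by move=> l m H; do 2!apply: tf_lt.
- by move=> l; apply: arrow_mul; apply: t_arrow.
- move=> l H; have -> : tk _ _ d l = one.
    by apply: tk_off => B; apply: H; apply/in_app_iff; left.
  rewrite mul_1r; apply: tk_off => B; apply: H; apply/in_app_iff; right.
  by rewrite -(tfK _ _ d l); apply: in_map.
- move=> l m H HB; rewrite (tf_aff _ _ e (tf _ _ d l)).
  + rewrite (tf_aff _ _ d l m) ?aff_comp // => b Hb; apply: HB.
    by apply/in_app_iff; left.
  + exact: tf_lt.
  + move=> b Hb /(tg_lt _ _ d) Hl /(tg_lt _ _ d) Hm; rewrite tfK in Hl; rewrite tfK in Hm.
    by apply: (HB (tg _ _ d b)) => //; apply/in_app_iff; right; apply: in_map.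
- move=> l m H HB; congr Z.add.
  + apply: tn_off; first exact: tf_lt.
    move=> b Hb /(tg_lt _ _ d) Hl; rewrite tfK in Hl; rewrite -(tgK _ _ d b); apply: tf_lt.
    by apply: HB => //; apply/in_app_iff; right; apply: in_map.
  + by apply: tn_off => // b Hb; apply: HB; apply/in_app_iff; left.
- case: (t_low _ _ d) (t_low _ _ e) => c Hc [c' Hc'].
  have [p [_ Hp]] := lt_min c c'; exists p => l /Hp [Hl Hl'].
  have [-> [-> ->]] := Hc _ Hl; have [-> [-> ->]] := Hc' _ Hl'.
  by rewrite mul_1l.
Qed.

Lemma track_inv (s : Sym) x : inhabited (track s x) -> inhabited (track (inv s) (s x)).
Proof.
case=> d; split.
refine (Track (inv s) (s x) (tg _ _ d) (tf _ _ d)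
  (fun l => inv (tk _ _ d (tg _ _ d l))) (fun l => (- tn _ _ d (tg _ _ d l))%Z)
  (map (tf _ _ d) (tB _ _ d)) _ _ _ _ _ _ _ _).
- exact: tgK.
- exact: tfK.
- exact: tg_lt.
- by move=> l; have := arrow_inv _ _ _ _ _ _ (t_arrow _ _ d (tg _ _ d l)); rewrite tgK.
- move=> l H; rewrite tk_off ?inv_one // => B; apply: H.
  by rewrite -(tgK _ _ d l); apply: in_map.
- move=> l m H HB.
  have E : m = aff (tg _ _ d l) l (tn _ _ d (tg _ _ d l)) (tg _ _ d m).
    rewrite -{2}(tgK _ _ d l) -tf_aff ?tgK //; first exact: tg_lt.
    move=> b Hb /(tf_lt _ _ d) Hl /(tf_lt _ _ d) Hm; rewrite tgK in Hl; rewrite tgK in Hm.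
    by apply: (HB (tf _ _ d b)) => //; apply: in_map.
  by rewrite {2}E aff_inv.
- move=> l m H HB; congr Z.opp; apply: tn_off; first exact: tg_lt.
  move=> b Hb /(tf_lt _ _ d) Hl; rewrite tgK in Hl; rewrite -(tfK _ _ d b); apply: tg_lt.
  by apply: HB => //; apply: in_map.
- case: (t_low _ _ d) => c Hc; exists c => l Hl.
  have [E1 [E2 E3]] := Hc _ Hl.
  have E : tg _ _ d l = l by rewrite -{1}E1 tfK.
  by rewrite E E2 E3 inv_one.
Qed.

(** * Supports and the group of tame permutations *)

Definition supp (v : level) (s : Sym) : Prop := forall y, ~ agree v base y -> s y = y.

Lemma supp_agree v s : supp v s -> forall y, agree v base y -> agree v base (s y).
Proof.
move=> H y Hy; apply: NNPP => N; have := H _ N => /(perm_inj _ s) E.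
by apply: N; rewrite E.
Qed.

(** Branches outside the cylinder are fixed and branches inside stay inside, so no branch changes
    below [v]. *)
Lemma supp_low v s : supp v s -> forall y, agree v y (s y).
Proof.
move=> H y; case: (classic (agree v base y)) => [Hy|/H -> //].
exact: agree_trans (agree_sym _ _ _ Hy) (supp_agree _ _ H _ Hy).
Qed.

Lemma supp_lt v w s : lt w v -> supp v s -> supp w s.
Proof. by move=> Hw H y Hy; apply: H => A; apply: Hy; apply: agree_lt Hw A. Qed.

Lemma supp_one v : supp v one. Proof. by []. Qed.

Lemma supp_mul v s t : supp v s -> supp v t -> supp v (mul s t).
Proof. by move=> Hs Ht y Hy /=; rewrite Ht // Hs. Qed.

Lemma supp_inv v s : supp v s -> supp v (inv s).
Proof. by move=> Hs y Hy /=; rewrite -{1}(Hs y Hy) pfunK. Qed.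

Definition tame (s : Sym) : Prop :=
  (exists v, supp v s) /\ forall x, inhabited (track s x).

Lemma tame_subgroup : is_subgroup Sym tame.
Proof.
split; last split.
- split; first by exists (lclass (fun _ => 0%R)); exact: supp_one.
  by move=> x; apply: track_one_arrows => l; apply: arrow_fix.
- move=> s t [[v Hv] Hs] [[w Hw] Ht]; split; last by move=> x; apply: track_mul.
  have [p [_ Hp]] := lt_min v w.
  (* A lower level means a larger cylinder; one strictly below [v] and [w] contains both
     supports. *)
  have [q Hq] := lt_below_seq (fun _ => p); have [Hqv Hqw] := Hp _ (Hq O).
  by exists q; apply: supp_mul; [apply: supp_lt Hv | apply: supp_lt Hw].
- move=> s [[v Hv] Hs]; split; first by exists v; exact: supp_inv.
  by move=> x; rewrite -(pinvK _ s x); apply: track_inv.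
Qed.

Lemma lt_below_list (s : list level) : exists p, forall l, In l s -> lt p l.
Proof.
have [p Hp] := lt_below_seq (fun n => nth n s (lclass (fun _ => 0%R))).
exists p => l /(In_nth _ _ (lclass (fun _ => 0%R))) [n [_ <-]]; exact: Hp.
Qed.

(** A branch has finitely many nontrivial letters, so it is trivial below all of them. *)
Lemma agree_base_low (w : omega) l : exists v, lt v l /\ agree v base w.
Proof.
case: (proj2_sig w) => s Hs; have [v Hv] := lt_below_list (l :: s).
exists v; split; first by apply: Hv; left.
move=> m Hm; symmetry; apply: Hs => Hin.
by apply: (lt_asym _ _ Hm); apply: Hv; right.
Qed.

(** Below [w] nothing changes, and from [w] on the cylinder around [x] misses the support, so all
    arrows at [x] are trivial. *)
Lemma supp_track_out v w (s : Sym) x : supp v s -> (forall y, agree w y (s y)) -> lt v w ->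
  ~ agree v base x -> inhabited (track s x).
Proof.
move=> Hv Hw Hvw Hx; apply: track_one_arrows => m.
case: (classic (lt m w)) => [Hm|Hm]; first exact: arrow_low Hw Hm.
apply: arrow_fix => y Hy; apply: Hv => Hb; apply: Hx.
apply: agree_trans Hb _ => q Hq; symmetry; apply: Hy.
by case: (lt_total m w) => [//|[->|H]]; [|apply: lt_trans H]; apply: lt_trans Hvw.
Qed.

(** * Letters: left translation of one coordinate on a cylinder *)

Definition letter_fun (w : omega) (l : level) (k : K) (y : omega) : omega :=
  if excluded_middle_informative (agree l w y) is left _ then upd y l (mul k (y l)) else y.

Lemma letter_fun_in (w : omega) l k (y : omega) :
  agree l w y -> letter_fun w l k y = upd y l (mul k (y l)).
Proof. by rewrite /letter_fun; case: excluded_middle_informative. Qed.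

Lemma letter_fun_out (w : omega) l k (y : omega) : ~ agree l w y -> letter_fun w l k y = y.
Proof. by rewrite /letter_fun; case: excluded_middle_informative. Qed.

Lemma agree_upd_self l (w y : omega) k : agree l w y -> agree l w (upd y l k).
Proof. by move=> H; apply: agree_trans H _; apply: agree_upd; apply: lt_irrefl. Qed.

Lemma letter_fun_mul w l k k' y :
  letter_fun w l k (letter_fun w l k' y) = letter_fun w l (mul k k') y.
Proof.
case: (classic (agree l w y)) => H; last by rewrite !letter_fun_out.
rewrite (letter_fun_in _ _ k' y) // letter_fun_in ?letter_fun_in //; last exact: agree_upd_self.
by rewrite upd_upd upd_same mul_assoc.
Qed.

Lemma letter_fun_one w l y : letter_fun w l one y = y.
Proof.
case: (classic (agree l w y)) => H; last by rewrite letter_fun_out.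
by rewrite letter_fun_in // mul_1l upd_id.
Qed.

Definition letter (w : omega) (l : level) (k : K) : Sym.
Proof.
refine (MkPerm omega (letter_fun w l k) (letter_fun w l (inv k)) _ _) => y.
  by rewrite letter_fun_mul mul_Vl letter_fun_one.
by rewrite letter_fun_mul mul_Vr letter_fun_one.
Defined.

Lemma letter_mul w l k k' : letter w l (mul k k') = mul (letter w l k) (letter w l k').
Proof. by apply: perm_ext => y; rewrite /= letter_fun_mul. Qed.

Lemma letter_inv w l k : letter w l (inv k) = inv (letter w l k).
Proof. by apply: perm_ext. Qed.

Lemma letter_pow w l k n : letter w l (powg k n) = powg (letter w l k) n.
Proof.
elim: n => [|n IH] /=; first by apply: perm_ext => y; exact: letter_fun_one.
by rewrite letter_mul IH.
Qed.

Lemma letter_other w l k (y : omega) m : m <> l -> letter w l k y m = y m.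
Proof.
move=> H; case: (classic (agree l w y)) => A.
  by rewrite /= letter_fun_in // upd_other.
by rewrite /= letter_fun_out.
Qed.

Lemma letter_low w l k y : agree l y (letter w l k y).
Proof. by move=> m Hm; rewrite letter_other //; exact: lt_neq. Qed.

Lemma agree_letter w l k v y y' : lt l v -> agree v y y' ->
  agree v (letter w l k y) (letter w l k y').
Proof.
move=> Hl H m Hm; rewrite /=.
have Hll := agree_lt _ _ _ _ Hl H.
case: (classic (agree l w y)) => A.
  rewrite !letter_fun_in //; last exact: agree_trans Hll.
  case: (classic (m = l)) => [->|N]; first by rewrite !upd_same H.
  by rewrite !upd_other // H.
rewrite !letter_fun_out // ?H // => A'; apply: A.
by apply: agree_trans A' _; apply: agree_sym.
Qed.

Lemma supp_letter l k : supp l (letter base l k).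
Proof. by move=> y; exact: letter_fun_out. Qed.

Lemma tame_letter w l k : tame (letter w l k).
Proof.
split.
  (* The cylinder of [w] at level [l] lies in the one of [base] at the lower level [v]. *)
  have [v [Hv Hw]] := agree_base_low w l; exists v => y Hy.
  apply: letter_fun_out => H; apply: Hy; apply: agree_trans Hw _.
  exact: agree_lt Hv H.
move=> x; case: (classic (agree l w x)) => Hx; last first.
  apply: track_one_arrows => m; case: (classic (lt m l)) => Hm.
    by apply: arrow_low Hm => y; exact: letter_low.
  apply: arrow_fix => y Hy; apply: letter_fun_out => A; apply: Hx.
  apply: agree_trans A _ => q Hq; symmetry; apply: Hy.
  by case: (lt_total m l) => [//|[->//|]]; apply: lt_trans.
(* On a branch through the cylinder of [w], levels are kept, all exponents vanish and [l] is the
   only breakpoint. *)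
split; refine (Track (letter w l k) x (fun m => m) (fun m => m)
  (fun m => if excluded_middle_informative (m = l) is left _ then k else one)
  (fun _ => 0%Z) (l :: nil) _ _ _ _ _ _ _ _) => //.
- move=> m; case: excluded_middle_informative => [->|Hm].
    split; last split.
    + move=> y; have Hx' := letter_low w l k x; have Hy' := letter_low w l k y.
      split=> A.
        exact: agree_trans (agree_sym _ _ _ Hx') (agree_trans _ _ _ _ A Hy').
      exact: agree_trans Hx' (agree_trans _ _ _ _ A (agree_sym _ _ _ Hy')).
    + move=> y A; rewrite /= letter_fun_in ?upd_same //; exact: agree_trans Hx A.
    + have [e He] := lt_above l; exists e; split=> // y A q Hq _.
      by rewrite aff0 letter_other // => E; subst q; exact: lt_irrefl Hq.
  case: (lt_total m l) => [Hlt|[//|Hlt]].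
    by apply: arrow_low Hlt => y; exact: letter_low.
  split; last split.
  + move=> y; split; first exact: agree_letter.
    move/(agree_letter w l (inv k) _ _ _ Hlt).
    by rewrite /= !letter_fun_mul mul_Vl !letter_fun_one.
  + by move=> y A; rewrite letter_other // mul_1l.
  + have [e He] := lt_above m; exists e; split=> // y A q Hq _.
    by rewrite aff0 letter_other // => E; subst q; exact: lt_asym Hq.
- by move=> m Hm; case: excluded_middle_informative => // E; case: Hm; left.
- by move=> *; rewrite aff0.
- exists l => m Hm; case: excluded_middle_informative => // E.
  by subst m; case: (lt_irrefl l).
Qed.

(** * Dilations of the levels *)

Definition warp (p : level) (n : Z) (m : level) : level :=
  if excluded_middle_informative (lt p m) is left _ then aff p p n m else m.

Lemma warp_in p n m : lt p m -> warp p n m = aff p p n m.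
Proof. by rewrite /warp; case: excluded_middle_informative. Qed.

Lemma warp_out p n m : ~ lt p m -> warp p n m = m.
Proof. by rewrite /warp; case: excluded_middle_informative. Qed.

Lemma warpK p n m : warp p (- n) (warp p n m) = m.
Proof.
case: (classic (lt p m)) => H; last by rewrite !warp_out.
rewrite (warp_in _ n) // warp_in ?aff_inv //; exact: aff_gt.
Qed.

Lemma warpK' p n m : warp p n (warp p (- n) m) = m.
Proof. by rewrite -{1}(Z.opp_involutive n) warpK. Qed.

Lemma warp_lt p n m m' : lt m m' -> lt (warp p n m) (warp p n m').
Proof.
move=> H; case: (classic (lt p m)) => Hm.
  rewrite !warp_in //; [exact: aff_lt | exact: lt_trans H].
rewrite (warp_out _ _ m) //; case: (classic (lt p m')) => Hm'.
  rewrite warp_in //.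
  case: (lt_total p m) => [//|[<-|H']]; first exact: aff_gt.
  by apply: lt_trans H' _; exact: aff_gt.
by rewrite warp_out.
Qed.

Lemma dil_finite p n (y : omega) :
  exists s : list level, forall m, ~ In m s -> y (warp p (- n) m) = one.
Proof.
case: (proj2_sig y) => s Hs; exists (map (warp p n) s) => m Hm; apply: Hs => H; apply: Hm.
by rewrite -(warpK' p n m); apply: in_map.
Qed.

Definition dil_fun (p : level) (n : Z) (y : omega) : omega :=
  if excluded_middle_informative (agree p base y) is left _
  then exist _ (fun m => y (warp p (- n) m)) (dil_finite p n y) else y.

Lemma dil_in p n y m : agree p base y -> dil_fun p n y m = y (warp p (- n) m).
Proof. by rewrite /dil_fun; case: excluded_middle_informative. Qed.

Lemma dil_out p n y : ~ agree p base y -> dil_fun p n y = y.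
Proof. by rewrite /dil_fun; case: excluded_middle_informative. Qed.

Lemma dil_low p n y : agree p y (dil_fun p n y).
Proof.
case: (classic (agree p base y)) => H; last by rewrite dil_out.
by move=> m Hm; rewrite dil_in // warp_out //; exact: lt_asym.
Qed.

Lemma dil_funK p n y : dil_fun p (- n) (dil_fun p n y) = y.
Proof.
case: (classic (agree p base y)) => H; last by rewrite !dil_out.
apply: omega_ext => m; rewrite dil_in; last exact: agree_trans H (dil_low _ _ _).
by rewrite dil_in // Z.opp_involutive warpK.
Qed.

Definition dil (p : level) : Sym.
Proof.
refine (MkPerm omega (dil_fun p 1) (dil_fun p (-1)) (dil_funK p 1) _) => y.
exact: (dil_funK p (-1) y).
Defined.

Lemma supp_dil p : supp p (dil p).
Proof. by move=> y; exact: dil_out. Qed.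

Lemma agree_dil p n l x y : agree p base x -> agree p base y ->
  agree l x y -> agree (warp p n l) (dil_fun p n x) (dil_fun p n y).
Proof.
move=> Hx Hy H m Hm; rewrite !dil_in //; apply: H.
by rewrite -(warpK p n l); apply: warp_lt.
Qed.

Lemma tame_dil p : tame (dil p).
Proof.
split; first by exists p; exact: supp_dil.
have low y : agree p y (dil p y) by exact: dil_low.
move=> x; case: (classic (agree p base x)) => Hx; last first.
  apply: track_one_arrows => m; case: (classic (lt m p)) => Hm; first exact: arrow_low Hm.
  apply: arrow_fix => y Hy; apply: dil_out => A; apply: Hx.
  apply: agree_trans A _ => q Hq; symmetry; apply: Hy.
  by case: (lt_total m p) => [//|[->//|]]; apply: lt_trans.
(* The exponent at [p] itself is already [1], because it describes the levels immediately above. *)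
split; refine (Track (dil p) x (warp p 1) (warp p (-1)) (fun _ => one)
  (fun m => if excluded_middle_informative (lt m p) is left _ then 0%Z else 1%Z)
  (p :: nil) (warpK p 1) _ (warp_lt p 1) _ _ _ _ _) => //.
- by move=> m; exact: (warpK p (-1) m).
- move=> l; case: excluded_middle_informative => Hl.
    by rewrite warp_out; [exact: arrow_low Hl | exact: lt_asym].
  have Hw m : ~ lt m p -> warp p 1 m = aff p p 1 m.
    move=> Hm; case: (lt_total m p) => [//|[->|H]]; last exact: warp_in.
    by rewrite aff_base warp_out //; exact: lt_irrefl.
  have sub m : lt m p -> lt m l.
    by case: (lt_total l p) => [//|[->//|H]] H'; apply: lt_trans H.
  have Hxy y : agree l x y -> agree p base y.
    by move=> A; apply: agree_trans Hx _ => m /sub; exact: A.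
  split; last split.
  + move=> y; split=> A; first by apply: agree_dil => //; exact: Hxy.
    have Hy : agree p base y.
      have A' : agree p (dil p x) (dil p y).
        move=> m Hm; apply: A.
        by rewrite -(warp_out p 1 m); [apply: warp_lt; exact: sub | exact: lt_asym].
      apply: agree_trans (agree_trans _ _ _ _ Hx (low x)) _.
      by apply: agree_trans A' (agree_sym _ _ _ (low y)).
    have Hdx : agree p base (dil p x) by exact: agree_trans Hx (low x).
    have Hdy : agree p base (dil p y) by exact: agree_trans Hy (low y).
    have := agree_dil p (-1) _ _ _ Hdx Hdy A.
    by rewrite (warpK p 1) /= !(dil_funK p 1).
  + by move=> y A; rewrite mul_1l /= dil_in ?(warpK p 1) //; exact: Hxy.
  + have [e He] := lt_above l; exists e; split=> // y A m Hm _.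
    rewrite /= dil_in; last exact: Hxy.
    have Hm' : ~ lt m p by move=> /sub; exact: lt_asym.
    by rewrite Hw // aff_rebase -Hw // (warpK p 1).
- move=> l m Hlm HB.
  case: excluded_middle_informative => Hl.
    have Hm : ~ lt p m by apply: HB => //; left.
    rewrite !warp_out ?aff0 //; exact: lt_asym.
  have [->|Hpl] : p = l \/ lt p l.
    by case: (lt_total l p) => [//|[->|]]; [left|right].
    by rewrite warp_in // (warp_out l 1 l) //; exact: lt_irrefl.
  by rewrite !warp_in ?aff_rebase //; exact: lt_trans Hlm.
- move=> l m Hlm HB.
  do 2!case: excluded_middle_informative => //.
  + by move=> Hl Hm; case: Hl; exact: lt_trans Hm.
  + by move=> Hl Hm; case: Hm; apply: HB => //; left.
- exists p => l Hl; rewrite warp_out; last exact: lt_asym.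
  by split=> //; split=> //; case: excluded_middle_informative.
Qed.

(** * Fans: wreath-type elements indexed by the letter at one level *)

(** The letter at [l] selects a permutation. It is erased before this permutation acts and restored
    afterwards, because the members of the families used are supported around [base], whose letter
    at [l] is trivial. *)
Definition fan_fun (l : level) (f : K -> Sym) (y : omega) : omega :=
  if excluded_middle_informative (agree l base y) is left _
  then upd (f (y l) (upd y l one)) l (y l) else y.

Lemma fan_in l f y :
  agree l base y -> fan_fun l f y = upd (f (y l) (upd y l one)) l (y l).
Proof. by rewrite /fan_fun; case: excluded_middle_informative. Qed.

Lemma fan_out l f y : ~ agree l base y -> fan_fun l f y = y.
Proof. by rewrite /fan_fun; case: excluded_middle_informative. Qed.

(** The common level [v] above [l] keeps every [f k] from touching the selecting letter and the
    levels below it. *)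
Definition deep (l : level) (f : K -> Sym) : Prop :=
  exists v, lt l v /\ forall k, supp v (f k) /\ tame (f k).

Lemma deep_mul l f g : deep l f -> deep l g -> deep l (fun k => mul (f k) (g k)).
Proof.
have [_ [TM _]] := tame_subgroup.
move=> [v [Hv Hf]] [w [Hw Hg]]; have [p [Hp Hpq]] := lt_min v w.
have Hlp : lt l p by case: Hp => ->.
have [q [Hq Hqp]] := lt_dense _ _ Hlp; have [Hqv Hqw] := Hpq _ Hqp.
exists q; split=> // k; case: (Hf k) (Hg k) => Sf Tf [Sg Tg]; split; last exact: TM.
by apply: supp_mul; [apply: supp_lt Sf | apply: supp_lt Sg].
Qed.

Lemma deep_inv l f : deep l f -> deep l (fun k => inv (f k)).
Proof.
have [_ [_ TV]] := tame_subgroup.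
move=> [v [Hv Hf]]; exists v; split=> // k; case: (Hf k) => Sf Tf.
by split; [exact: supp_inv | exact: TV].
Qed.

Lemma deep_low l f k y : deep l f -> agree l y (f k y) /\ f k y l = y l.
Proof.
move=> [v [Hv Hf]]; case: (Hf k) => /supp_low /(_ y) H _.
by split; [apply: agree_lt H | rewrite -H].
Qed.

Lemma fan_mul_fun l f g y : deep l g ->
  fan_fun l f (fan_fun l g y) = fan_fun l (fun k => mul (f k) (g k)) y.
Proof.
move=> Dg; case: (classic (agree l base y)) => H; last by rewrite !fan_out.
rewrite (fan_in l g y H) (fan_in l (fun k => mul (f k) (g k)) y H).
have [A B] := deep_low _ _ (y l) (upd y l one) Dg.
rewrite fan_in.
  by rewrite upd_same upd_upd (upd_id (g _ _)) // B upd_same.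
apply: agree_upd_self; apply: agree_trans A.
exact: agree_upd_self.
Qed.

Lemma fan_one_fun l y : fan_fun l (fun _ => one) y = y.
Proof.
case: (classic (agree l base y)) => H; last by rewrite fan_out.
by rewrite fan_in //= upd_upd upd_id.
Qed.

Definition is_fan l f (F : Sym) : Prop := forall y, F y = fan_fun l f y.

Lemma is_fan_mul l f g F G : deep l g -> is_fan l f F -> is_fan l g G ->
  is_fan l (fun k => mul (f k) (g k)) (mul F G).
Proof. by move=> Dg HF HG y; rewrite /= HF HG fan_mul_fun. Qed.

Lemma is_fan_inv l f F : deep l f -> is_fan l f F -> is_fan l (fun k => inv (f k)) (inv F).
Proof.
move=> Df HF y; apply: (perm_inj _ F); rewrite /= pinvK HF fan_mul_fun; last exact: deep_inv.
have -> : (fun k => mul (f k) (inv (f k))) = fun _ => one.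
  by apply: functional_extensionality => k; rewrite mul_Vr.
by rewrite fan_one_fun.
Qed.

Lemma is_fan_eq l f g F G : (forall k, f k = g k) -> is_fan l f F -> is_fan l g G -> F = G.
Proof.
move=> /functional_extensionality <- HF HG; apply: perm_ext => y.
by rewrite HF HG.
Qed.

Lemma letter_base_in l k y : agree l base y -> letter base l k y = upd y l (mul k (y l)).
Proof. exact: letter_fun_in. Qed.

(** Conjugation by a letter translates the index, as in the wreath product with the regular action
    of [K]. *)
Lemma is_fan_conj_letter l f F k : deep l f -> is_fan l f F ->
  is_fan l (fun h => f (mul (inv k) h)) (conjg (letter base l k) F).
Proof.
move=> Df HF y; rewrite /conjg -letter_inv.
have E : mul (mul (letter base l k) F) (letter base l (inv k)) y =
  letter base l k (F (letter base l (inv k) y)) by [].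
rewrite E HF; case: (classic (agree l base y)) => H.
  rewrite (letter_base_in l (inv k) y H) fan_in; last exact: agree_upd_self.
  rewrite upd_same upd_upd fan_in //.
  rewrite letter_base_in; last first.
    apply: agree_upd_self; apply: agree_trans (proj1 (deep_low _ _ _ _ Df)).
    exact: agree_upd_self.
  by rewrite upd_upd upd_same mul_KV.
by rewrite /= letter_fun_out // !fan_out // letter_fun_out.
Qed.

(** The support condition makes [g] move only branches with trivial letter at [l], where erasing and
    restoring this letter changes nothing. *)
Lemma is_fan_single l f F g : (forall k, k <> one -> f k = one) -> f one = g ->
  (exists v, lt l v /\ supp v g) -> is_fan l f F -> F = g.
Proof.
move=> f1 fg [v [Hv Sg]] HF; apply: perm_ext => y; rewrite HF.
case: (classic (agree l base y)) => H; last first.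
  by rewrite fan_out // Sg // => A; apply: H; apply: agree_lt A.
rewrite fan_in //; case: (classic (y l = one)) => E.
  rewrite E fg (upd_id _ _ _ E) upd_id //.
  by rewrite -(supp_low _ _ Sg).
rewrite f1 //= upd_upd upd_id // Sg // => A; apply: E.
by rewrite -A.
Qed.

Lemma arrow_congr (s t : Sym) x l l' k n : (forall y, agree l x y -> t y = s y) ->
  arrow s x l l' k n -> arrow t x l l' k n.
Proof.
move=> E [H1 [H2 [e [He H3]]]]; split; last split.
- move=> y; rewrite (E x) //; split=> A; first by rewrite E //; apply/H1.
  have A' : agree l x (pinv s (t y)) by apply/H1; rewrite pinvK.
  have Ey : pinv s (t y) = y by apply: (perm_inj _ t); rewrite E // pinvK.
  by rewrite -Ey.
- by move=> y A; rewrite E // H2.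
- by exists e; split=> // y A m Hm Hme; rewrite E // H3.
Qed.

(** A track refers to the permutation only through its arrows, so all other data can be reused. *)
Lemma track_change (s t : Sym) x :
  (forall l l' k n, arrow s x l l' k n -> arrow t x l l' k n) ->
  inhabited (track s x) -> inhabited (track t x).
Proof.
move=> H [d]; split.
exact: (Track t x (tf _ _ d) (tg _ _ d) (tk _ _ d) (tn _ _ d) (tB _ _ d) (tfK _ _ d)
  (tgK _ _ d) (tf_lt _ _ d) (fun l => H _ _ _ _ (t_arrow _ _ d l)) (tk_off _ _ d)
  (tf_aff _ _ d) (tn_off _ _ d) (t_low _ _ d)).
Qed.

Variable z : K.
Hypothesis z_pow : forall n, powg z (S n) <> one.

Lemma K_nontrivial : exists k : K, k <> one.
Proof. by exists z => E; apply: (z_pow 0); rewrite /= mul_1r. Qed.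

Lemma fan_exists l f : deep l f -> exists F, tame F /\ supp l F /\ is_fan l f F.
Proof.
move=> Df; have Dv := deep_inv _ _ Df.
have EV y : fan_fun l (fun k => inv (f k)) (fan_fun l f y) = y.
  rewrite fan_mul_fun // -{2}(fan_one_fun l y); congr fan_fun.
  by apply: functional_extensionality => k; rewrite mul_Vl.
have EV' y : fan_fun l f (fan_fun l (fun k => inv (f k)) y) = y.
  rewrite fan_mul_fun // -{2}(fan_one_fun l y); congr fan_fun.
  by apply: functional_extensionality => k; rewrite mul_Vr.
pose F : Sym := MkPerm omega (fan_fun l f) (fan_fun l (fun k => inv (f k))) EV EV'.
have SF : supp l F by move=> y; exact: fan_out.
exists F; split; last by split.
split; first by exists l.
have [v [Hv Hf]] := Df.
have lowF y : agree v y (F y).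
  case: (classic (agree l base y)) => H; last by rewrite SF.
  move=> m Hm; rewrite /= fan_in //; case: (classic (m = l)) => [->|N].
    by rewrite upd_same.
  rewrite upd_other //; case: (Hf (y l)) => /supp_low /(_ (upd y l one) m Hm) <- _.
  by rewrite upd_other.
move=> x; case: (classic (agree l base x)) => Hx; last exact: supp_track_out SF lowF Hv Hx.
(* On the points with the same letter as [x] at level [l], the fan is a conjugate of a single
   [f k], from which it inherits its track at [x]. *)
pose a := letter base l (x l).
have Ts : tame (conjg a (f (x l))).
  by apply: subgroup_conj tame_subgroup (tame_letter _ _ _) (proj2 (Hf _)).
have Es y : conjg a (f (x l)) y = a (f (x l) (letter base l (inv (x l)) y)) by [].
apply: track_change (proj2 Ts x) => m m' k n A.
(* Below [v] both permutations keep all branches, so by uniqueness [A] is trivial. From [v] on, the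
   cylinder determines the letter at [l], and both permutations coincide on it. *)
case: (classic (lt m v)) => Hm.
  have A' : arrow (conjg a (f (x l))) x m m one 0.
    apply: (arrow_low _ v) Hm => y; rewrite Es.
    have E : letter base l (x l) (letter base l (inv (x l)) y) = y.
      by rewrite /= letter_fun_mul mul_Vr letter_fun_one.
    rewrite -{1}E; apply: agree_letter Hv _.
    exact: (supp_low _ _ (proj1 (Hf (x l)))).
  have [-> [-> ->]] := arrow_unique _ _ _ _ _ _ _ _ _ K_nontrivial A A'.
  exact: arrow_low Hm.
apply: arrow_congr A => y Hy.
have Hlm : lt l m by case: (lt_total m v) => [//|[->//|]]; apply: lt_trans.
have Hy' : agree l base y by apply: agree_trans Hx (agree_lt _ _ _ _ Hlm Hy).
rewrite Es /= fan_in // (letter_fun_in base l (inv (x l))) // -(Hy l Hlm) mul_Vl.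
rewrite letter_fun_in.
  by rewrite (proj2 (deep_low _ _ _ _ Df)) upd_same mul_1r.
apply: agree_trans (proj1 (deep_low _ _ _ _ Df)).
exact: agree_upd_self.
Qed.

(** * Displaced cylinders and commutators *)

Lemma lt_above2 l m : exists p, lt l p /\ lt m p.
Proof.
case: (lt_total l m) => [H|[<-|H]].
- by have [p Hp] := lt_above m; exists p; split=> //; exact: lt_trans Hp.
- by have [p Hp] := lt_above l; exists p.
- by have [p Hp] := lt_above l; exists p; split=> //; exact: lt_trans Hp.
Qed.

(** The finitely many levels below [l] at which [x] is nontrivial are corrected one at a time by
    letters. *)
Lemma exists_cylinder_map l (x : omega) :
  exists c, tame c /\ forall y, agree l base y -> agree l x (c y).
Proof.
have [T1 [TM TV]] := tame_subgroup.
(* Generalized to any start branch [w] that differs from [x] below [l] only on a list [t]. *)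
suff main : forall t (w : omega), (forall m, lt m l -> ~ In m t -> w m = x m) ->
    exists c, tame c /\ forall y, agree l w y -> agree l x (c y).
  by case: (proj2_sig x) => t Ht; apply: (main t) => m _ Hm; symmetry; exact: Ht.
elim=> [|m t IH] w Hw.
  exists one; split=> // y A; apply: agree_trans A => m Hm.
  by rewrite Hw.
case: (classic (lt m l)) => Hm; last first.
  by apply: IH => p Hp Ht; apply: Hw => // -[E|//]; subst p.
have [|c [Tc Hc]] := IH (upd w m (x m)).
  move=> p Hp Ht; case: (classic (p = m)) => [->|N]; first by rewrite upd_same.
  by rewrite upd_other //; apply: Hw => // -[E|//]; apply: N.
pose a := letter w m (mul (x m) (inv (w m))).
exists (mul c a); split; first by apply: TM => //; exact: tame_letter.
move=> y A; apply: Hc.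
have -> : upd w m (x m) = a w.
  by rewrite /a /= letter_fun_in // -mul_assoc mul_Vl mul_1r.
exact: agree_letter.
Qed.

(** A dilation centred below [l0] pushes [l0] above [l1], shrinking the cylinder of [base]; then
    [exists_cylinder_map] carries it to [x]. *)
Lemma exists_squeeze l0 l1 (x : omega) :
  exists h, tame h /\ forall y, agree l0 base y -> agree l1 x (h y).
Proof.
have [l2 [H0 H1]] := lt_above2 l0 l1.
have [c [Tc Hc]] := exists_cylinder_map l2 x.
have [p [Hp Ep]] := aff_move _ _ H0.
exists (mul c (dil p)); split.
  by apply: (proj1 (proj2 tame_subgroup)) => //; exact: tame_dil.
move=> y A; apply: agree_lt H1 _; apply: Hc.
have := agree_dil p 1 l0 base y (agree_refl _ _) (agree_lt _ _ _ _ Hp A) A.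
rewrite warp_in // Ep.
by have -> : dil_fun p 1 base = base by apply: omega_ext => m; rewrite dil_in.
Qed.

Lemma exists_displaced_cylinder a : tame a -> a <> one ->
  exists x l, forall y, agree l x y -> ~ agree l x (a y).
Proof.
move=> [_ Ta] Na.
have [x [m Hm]] : exists x m, a x m <> x m.
  apply: NNPP => N; apply: Na; apply: perm_ext => x; apply: omega_ext => m.
  by apply: NNPP => E; apply: N; exists x, m.
case: (Ta x) => d.
(* With [l] above [m] and its preimage, branches agreeing with [x] below [l] share the letter of [x]
   at [m], and their images share that of [a x]. *)
have [l [Hl Hl']] := lt_above2 m (tg _ _ d m).
exists x, l => y A B; apply: Hm.
have := tf_lt _ _ d _ _ Hl'; rewrite tgK => /(proj1 (proj1 (t_arrow _ _ d l) y) A) ->.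
by rewrite -B.
Qed.

Lemma pow_inj m n : powg z m = powg z n -> m = n.
Proof.
have main p q : powg z p = powg z (p + q) -> q = 0.
  case: q => // q E; case: (z_pow q); apply: (mul_cancel_l _ (powg z p)).
  by rewrite mul_1r -pow_add.
move=> E; have [H|H] := Nat.le_ge_cases m n.
  have := main m (n - m); rewrite Nat.add_comm Nat.sub_add //; move/(_ E); lia.
have := main n (m - n); rewrite Nat.add_comm Nat.sub_add //; move/(_ (eq_sym E)); lia.
Qed.

Lemma is_fan_comm l f g F G : deep l f -> deep l g -> is_fan l f F -> is_fan l g G ->
  is_fan l (fun k => commg (f k) (g k)) (commg F G).
Proof.
move=> Df Dg HF HG.
have Df' := deep_inv _ _ Df; have Dg' := deep_inv _ _ Dg.
apply: is_fan_mul; [exact: deep_mul | exact: is_fan_mul |].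
by apply: is_fan_mul => //; apply: is_fan_inv.
Qed.

(* With [phi] equal to [g] on the letters [z ^ n], [n >= 0], and trivial on the other letters,
   the commutator of [phi] with the shift [z] is concentrated on the letter [one]. *)
Lemma tame_is_comm l v g : lt l v -> supp v g -> tame g ->
  exists phi, tame phi /\ supp l phi /\ g = commg phi (letter base l z).
Proof.
move=> Hlv Sg Tg.
pose f (h : K) : Sym :=
  if excluded_middle_informative (exists n, h = powg z n) is left _ then g else one.
have f_in n : f (powg z n) = g.
  by rewrite /f; case: excluded_middle_informative => // N; case: N; exists n.
have f_out h : ~ (exists n, h = powg z n) -> f h = one.
  by rewrite /f; case: excluded_middle_informative.
have Df : deep l f.
  exists v; split=> // h; rewrite /f; case: excluded_middle_informative => // _.
  by split; [exact: supp_one | exact: (proj1 tame_subgroup)].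
have [phi [Tphi [Sphi Hphi]]] := fan_exists _ _ Df.
exists phi; split=> //; split=> //; symmetry.
have Dv := deep_inv _ _ Df.
have HV := is_fan_conj_letter _ _ _ z Dv (is_fan_inv _ _ _ Df Hphi).
have Dv' : deep l (fun h => inv (f (mul (inv z) h))).
  by case: Dv => w [Hw HD]; exists w; split.
have := is_fan_mul _ _ _ _ _ Dv' Hphi HV.
have -> : mul phi (conjg (letter base l z) (inv phi)) = commg phi (letter base l z).
  by rewrite /conjg /commg !mul_assoc.
apply: is_fan_single; last by exists v.
- move=> k Nk; case: (classic (exists n, k = powg z n)) => [[[|n] E]|N].
  + by case: Nk.
  + have -> : mul (inv z) k = powg z n by rewrite E; exact: mul_VK.
    by rewrite E !f_in mul_Vr.
  + rewrite !f_out ?mul_Vr // => -[n E]; apply: N; exists (S n).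
    by rewrite /= -E mul_KV.
(* Since [z] has infinite order, [inv z] is no nonnegative power of it, so only [phi] acts at the
   letter [one]. *)
- rewrite (f_in 0) f_out ?inv_one ?mul_1r // => -[n E].
  by case: (z_pow n); rewrite /= -E mul_Vr.
Qed.

Lemma perm_commute (J : omega -> Prop) (q w : Sym) :
  (forall y, J y -> q y = y) -> (forall y, ~ J y -> w y = y) -> mul q w = mul w q.
Proof.
move=> Hq Hw; apply: perm_ext => y /=; case: (classic (J y)) => Jy.
  rewrite (Hq _ Jy) Hq //; apply: NNPP => N.
  by have := Hw _ N => /(perm_inj _ w) E; apply: N; rewrite E.
rewrite (Hw _ Jy) Hw // => N.
by have := Hq _ N => /(perm_inj _ q) E; apply: Jy; rewrite -E.
Qed.

(** Displacement trick: [b] is the commutator of [g1] and [g2], and [h] carries their supports into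
    a cylinder moved off itself by [a]. The commutator of [conjg h g1] with [a] is [conjg h g1]
    times a factor supported off that cylinder, which commutes with [conjg h g2] and drops out. *)
Lemma tame_conj_comm a b : tame a -> a <> one -> tame b ->
  exists g1 g2 h, tame g1 /\ tame g2 /\ tame h /\
    b = conjg (inv h) (commg (commg (conjg h g1) a) (conjg h g2)).
Proof.
move=> Ta Na Tb; case: (Tb) => -[v Sb] _.
have [l Hl] := lt_below_seq (fun _ => v); have {}Hl := Hl O.
have [g1 [T1 [S1 Eb]]] := tame_is_comm _ _ _ Hl Sb Tb.
pose g2 := letter base l z; have S2 : supp l g2 := supp_letter l z.
have [x [l1 Hx]] := exists_displaced_cylinder _ Ta Na.
have [h [Th Hh]] := exists_squeeze l l1 x.
exists g1, g2, h; split=> //; split; first exact: tame_letter.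
split=> //.
have out g y : supp l g -> ~ agree l1 x y -> conjg h g y = y.
  move=> Sg N; rewrite /= Sg ?pinvK // => A; apply: N.
  by have := Hh _ A; rewrite pinvK.
have out1 y := out g1 y S1; have out2 y := out g2 y S2.
have Q : mul (conjg a (inv (conjg h g1))) (conjg h g2) =
         mul (conjg h g2) (conjg a (inv (conjg h g1))).
  apply: (perm_commute (agree l1 x)) => // y Jy.
  have N : ~ agree l1 x (pinv a y) by move=> /Hx; rewrite pinvK.
  have E := out1 _ N.
  have Ei : inv (conjg h g1) (pinv a y) = pinv a y.
    by apply: (perm_inj _ (conjg h g1)); rewrite E; exact: pinvK.
  have E2 : conjg a (inv (conjg h g1)) y = a (inv (conjg h g1) (pinv a y)) by [].
  by rewrite E2 Ei pinvK.
have -> : commg (commg (conjg h g1) a) (conjg h g2) = commg (conjg h g1) (conjg h g2).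
  by rewrite (comm_conj_inv _ (conjg h g1) a) comm_mul_l.
by rewrite conj_comm !conj_VK.
Qed.

(** * Sequences as words in two elements *)

Lemma choice_fun (A B : Type) (R : A -> B -> Prop) :
  (forall a, exists b, R a b) -> exists f, forall a, R a (f a).
Proof.
move=> H; exists (fun a => proj1_sig (constructive_indefinite_description _ (H a))) => a.
exact: proj2_sig.
Qed.

(* The exponents [0] and [2 n + 1] are spaced so that the commutator retains only the pair [t],
   [phi n]. *)
Lemma tame_seq_words (g : nat -> Sym) : (forall n, tame (g n)) ->
  exists psi s, tame psi /\ tame s /\
    forall n, g n = commg (conjg (inv (powg s (2 * n + 1))) psi) psi.
Proof.
move=> Tg.
have [v Hv] := choice_fun _ _ _ (fun n => proj1 (Tg n)).
have [w Hw] := lt_below_seq v.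
have [phi Hphi] := choice_fun _ _ _ (fun n => tame_is_comm _ _ _ (Hw n) (Hv n) (Tg n)).
have [l Hl] := lt_below_seq (fun _ => w); have {}Hl := Hl O.
pose t := letter base w z.
(* The letter [one] carries [t] and [z ^ (2 n + 1)] carries [phi n]; conjugating by a power of the
   letter shift brings [phi n] to the letter [one]. *)
pose f (h : K) : Sym :=
  if excluded_middle_informative (h = one) is left _ then t else
  if excluded_middle_informative (exists n, h = powg z (2 * n + 1)) is left H
  then phi (proj1_sig (constructive_indefinite_description _ H)) else one.
have f1 : f one = t by rewrite /f; case: excluded_middle_informative.
have pow_odd n : powg z (2 * n + 1) <> one.
  by rewrite Nat.add_comm; exact: z_pow.
have f_odd n : f (powg z (2 * n + 1)) = phi n.
  rewrite /f; case: excluded_middle_informative => [/pow_odd //|_].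
  case: excluded_middle_informative => [H|[]]; last by exists n.
  case: constructive_indefinite_description => m /= /pow_inj E.
  by congr phi; lia.
have f_out h : h <> one -> ~ (exists n, h = powg z (2 * n + 1)) -> f h = one.
  move=> N1 N2; rewrite /f; case: excluded_middle_informative => // _.
  by case: excluded_middle_informative.
have Df : deep l f.
  exists w; split=> // h; rewrite /f; case: excluded_middle_informative => [_|_].
    by split; [exact: supp_letter | exact: tame_letter].
  case: excluded_middle_informative => [H|_].
    by case: (Hphi (proj1_sig (constructive_indefinite_description _ H))) => ? [].
  by split; [exact: supp_one | exact: (proj1 tame_subgroup)].
have [psi [Tpsi [_ Hpsi]]] := fan_exists _ _ Df.
exists psi, (letter base l z); split=> //; split; first exact: tame_letter.
move=> n; rewrite -letter_pow -letter_inv; symmetry.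
have := is_fan_conj_letter _ _ _ (inv (powg z (2 * n + 1))) Df Hpsi.
rewrite inv_inv => Hc.
have Dc : deep l (fun h => f (mul (powg z (2 * n + 1)) h)).
  by case: Df => p [Hp HD]; exists p; split.
apply: is_fan_single (is_fan_comm _ _ _ _ _ Dc Df Hc Hpsi).
- have comm_1l (s : Sym) : commg one s = one by rewrite /commg inv_one !mul_1l mul_Vr.
  have comm_1r (s : Sym) : commg s one = one by rewrite /commg inv_one !mul_1r mul_Vr.
  move=> k Nk; case: (classic (exists m, k = powg z (2 * m + 1))) => [[m E]|N]; last first.
    by rewrite (f_out k).
  (* A product of two odd powers of [z] is a positive even power, where [f] is trivial. *)
  rewrite (f_out (mul _ k)) // E -pow_add.
    have -> : 2 * n + 1 + (2 * m + 1) = S (2 * n + 2 * m + 1) by lia.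
    exact: z_pow.
  by move=> [p /pow_inj Hp]; lia.
- by rewrite mul_1r f_odd f1; case: (Hphi n) => _ [_ <-].
- by exists (v n); split=> //; exact: lt_trans (Hw n).
Qed.

(** * Embedding of [nat -> K] *)

(** The sequence [u] acts as a fan that applies [u n] at level [w] on branches with letter [z ^ n]
    at level [l]; a suitable test branch reads [u n] back. *)
Lemma exists_seq_embedding : exists iota : (nat -> K) -> Sym,
  (forall u, tame (iota u)) /\
  (forall u v, iota (fun n => mul (u n) (v n)) = mul (iota u) (iota v)) /\
  (forall u v, iota u = iota v -> u = v).
Proof.
pose w := lclass (fun _ => 0%R).
have [l Hl] := lt_below_seq (fun _ => w); have {}Hl := Hl O.
(* The value on letters that are not powers of [z] is arbitrary; the family is multiplicative in [u]
   at every letter. *)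
pose idx (h : K) : nat := epsilon (inhabits 0) (fun n => h = powg z n).
have idxE n : idx (powg z n) = n.
  by apply: pow_inj; symmetry; apply: (epsilon_spec _ (fun m => powg z n = powg z m)); exists n.
pose f (u : nat -> K) h := letter base w (u (idx h)).
have Df u : deep l (f u).
  by exists w; split=> // k; split; [exact: supp_letter | exact: tame_letter].
have [iota Hi] := choice_fun _ _ _ (fun u => fan_exists _ _ (Df u)).
exists iota; split; first by move=> u; case: (Hi u).
split.
  move=> u v; case: (Hi u) (Hi v) => [_ [_ Fu]] [_ [_ Fv]].
  apply: is_fan_eq (proj2 (proj2 (Hi _))) (is_fan_mul _ _ _ _ _ (Df v) Fu Fv) => k.
  exact: letter_mul.
move=> u v E; apply: functional_extensionality => n.
have val r : iota r (upd base l (powg z n)) w = r n.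
  case: (Hi r) => _ [_ ->]; rewrite fan_in; last by apply: agree_upd_self.
  rewrite upd_same upd_upd (upd_id base) // upd_other; last first.
    by move=> Ew; move: Hl; rewrite Ew; exact: lt_irrefl.
  by rewrite /f idxE letter_base_in // upd_same mul_1r.
by rewrite -(val u) -(val v) E.
Qed.

(** * Skolem functions *)

(** The functions default to [one] when the conditions on [a] and [b] fail. All values are thus
    tame, and closing a set of tame elements under them stays inside [tame]. *)
Lemma tame_conj_comm_skolem : exists c1 c2 c3 : Sym -> Sym -> Sym, forall a b,
  tame (c1 a b) /\ tame (c2 a b) /\ tame (c3 a b) /\
  (tame a -> a <> one -> tame b ->
    b = conjg (inv (c3 a b)) (commg (commg (conjg (c3 a b) (c1 a b)) a) (conjg (c3 a b) (c2 a b)))).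
Proof.
have [|c Hc] := choice_fun (Sym * Sym) (Sym * Sym * Sym) (fun p q =>
  tame (fst (fst q)) /\ tame (snd (fst q)) /\ tame (snd q) /\
  (tame (fst p) -> fst p <> one -> tame (snd p) ->
    snd p = conjg (inv (snd q))
      (commg (commg (conjg (snd q) (fst (fst q))) (fst p))
        (conjg (snd q) (snd (fst q)))))); last first.
  exists (fun a b => fst (fst (c (a, b)))), (fun a b => snd (fst (c (a, b)))),
    (fun a b => snd (c (a, b))) => a b.
  exact: (Hc (a, b)).
move=> [a b]; case: (classic (tame a /\ a <> one /\ tame b)) => [[Ta [Na Tb]]|N].
  have [g1 [g2 [h [U1 [U2 [Uh E]]]]]] := tame_conj_comm a b Ta Na Tb.
  by exists (g1, g2, h).
have T1 := proj1 tame_subgroup.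
exists (one : Sym, one : Sym, one : Sym); do 3!split=> //.
by move=> Ta Na Tb; case: N.
Qed.

Lemma tame_seq_words_skolem : exists e1 e2 : (nat -> Sym) -> Sym, forall g,
  tame (e1 g) /\ tame (e2 g) /\ ((forall n, tame (g n)) -> forall n,
    g n = commg (conjg (inv (powg (e2 g) (2 * n + 1))) (e1 g)) (e1 g)).
Proof.
have [|e He] := choice_fun (nat -> Sym) (Sym * Sym) (fun g q =>
  tame (fst q) /\ tame (snd q) /\ ((forall n, tame (g n)) -> forall n,
    g n = commg (conjg (inv (powg (snd q) (2 * n + 1))) (fst q)) (fst q))); last first.
  by exists (fun g => fst (e g)), (fun g => snd (e g)).
move=> g; case: (classic (forall n, tame (g n))) => [Tg|N].
  by have [psi [s [Tpsi [Ts E]]]] := tame_seq_words g Tg; exists (psi, s).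
by exists (one : Sym, one : Sym); split; [|split=> //]; exact: (proj1 tame_subgroup).
Qed.

(** * Local indicability *)

Definition trivial_at s x (d : track s x) l : Prop :=
  tf _ _ d l = l /\ tk _ _ d l = one /\ tn _ _ d l = 0%Z.

(** Uniqueness of arrows makes triviality independent of the chosen track. *)
Lemma trivial_at_arrow s x (d : track s x) l :
  trivial_at s x d l <-> arrow s x l l one 0.
Proof.
have A := t_arrow _ _ d l; split=> [[E1 [E2 E3]]|B].
  by move: A; rewrite E1 E2 E3.
exact: arrow_unique K_nontrivial A B.
Qed.

Lemma greatest_below (t : list level) l0 m : lt l0 m ->
  exists l, (l = l0 \/ In l t) /\ lt l m /\ forall b, In b t -> lt l b -> ~ lt b m.
Proof.
move=> H0; elim: t => [|c t [l [Hl [Hlm IH]]]]; first by exists l0; split; [left|].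
case: (classic (lt l c /\ lt c m)) => [[Hlc Hcm]|N].
  exists c; split; first by right; left.
  split=> // b [<-|Hb] Hcb; first by case: (lt_irrefl _ Hcb).
  by apply: IH => //; exact: lt_trans Hcb.
exists l; split; first by case: Hl => [|Hl]; [left | right; right].
by split=> // b [<-|Hb] Hlb; [move=> Hbm; apply: N | exact: IH].
Qed.

(** A track is trivial at very low levels. From the last breakpoint below [m], or from such a low
    level, it is affine up to [m] with constant exponent, so triviality propagates. *)
Lemma trivial_below s x (d : track s x) m :
  (forall b, In b (tB _ _ d) -> lt b m -> trivial_at s x d b) ->
  tf _ _ d m = m /\ (~ In m (tB _ _ d) -> trivial_at s x d m).
Proof.
move=> HB; case: (t_low _ _ d) => c Hc.
have [p [_ Hp]] := lt_min c m.
have [l0 Hl0] := lt_below_seq (fun _ => p); have [H0c H0m] := Hp _ (Hl0 O).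
have [l [Hl [Hlm Hgap]]] := greatest_below (tB _ _ d) l0 m H0m.
have [E1 [E2 E3]] : trivial_at s x d l.
  by case: Hl => [->|Hl]; [exact: Hc | exact: HB].
have Em : tf _ _ d m = m by rewrite (tf_aff _ _ d l m) // E1 E3 aff0.
split=> // Hm; split=> //; split; first exact: tk_off.
rewrite (tn_off _ _ d l m) // => b Hb Hlb.
case: (lt_total b m) => [/(Hgap _ Hb Hlb) //|[E|//]].
by subst b.
Qed.

Lemma least_in_list (P : level -> Prop) (t : list level) : (exists b, In b t /\ P b) ->
  exists b, In b t /\ P b /\ forall c, In c t -> lt c b -> ~ P c.
Proof.
elim: t => [[b []] //|a t IH [b [Hb Pb]]].
case: (classic (exists b, In b t /\ P b)) => [/IH [c [Hc [Pc Hmin]]]|N].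
  case: (classic (P a /\ lt a c)) => [[Pa Hac]|Na].
    exists a; split; first by left.
    split=> // p [<-|Hp] Hpa; first by case: (lt_irrefl _ Hpa).
    by apply: Hmin => //; exact: lt_trans Hac.
  exists c; split; first by right.
  by split=> // p [<-|Hp] Hpc; [move=> Pa; apply: Na | exact: Hmin].
exists a; split; first by left.
case: Hb => [E|Hb]; last by case: N; exists b.
subst b; split=> // p [<-|Hp] Hpa Pp; first by case: (lt_irrefl _ Hpa).
by apply: N; exists p.
Qed.

(** A finite common list makes a least nontrivial level exist, although the levels are not well
    ordered. *)
Lemma common_breaks (T : list Sym) x : (forall s, In s T -> tame s) ->
  exists L, forall s, In s T -> exists d : track s x, forall b, In b (tB _ _ d) -> In b L.
Proof.
elim: T => [|s T IH] HT; first by exists nil.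
have [L HL] := IH (fun s Hs => HT s (or_intror Hs)).
case: (HT s (or_introl eq_refl)) => _ /(_ x) [d].
exists (tB _ _ d ++ L) => s' [<-|/HL [d' Hd']].
  by exists d => b Hb; apply/in_app_iff; left.
by exists d' => b /Hd' Hb; apply/in_app_iff; right.
Qed.

(** Permutations with a germ at a fixed node stabilize it, and their pairs of letter and exponent
    multiply as in [K * Z]. *)
Definition local_germ (x : omega) (b : level) (s : Sym) (k : K) (n : Z) : Prop :=
  agree b x (s x) /\ arrow s x b b k n.

Lemma exists_first_germ (T : list Sym) : (forall s, In s T -> tame s) ->
  (exists s, In s T /\ s <> one) ->
  exists x b, (forall s, In s T -> exists k n, local_germ x b s k n) /\
    exists s k n, In s T /\ local_germ x b s k n /\ (k <> one \/ n <> 0%Z).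
Proof.
move=> HT [s [Hs Ns]].
have [x Nx] : exists x, s x <> x.
  by apply: NNPP => N; apply: Ns; apply: perm_ext => x; apply: NNPP => E; apply: N; exists x.
have [L HL] := common_breaks T x HT.
pose bad b := exists s, In s T /\ ~ arrow s x b b one 0.
have [|b [Hb [[s' [Hs' Bs']] Hmin]]] := least_in_list bad L.
  (* If no breakpoint were bad, the arrows of [s] along [x] would all be trivial and [s] would fix
     [x]. *)
  apply: NNPP => N; apply: Nx; apply: omega_ext => m.
  have [d Hd] := HL _ Hs.
  have Hall b : In b (tB _ _ d) -> trivial_at s x d b.
    move=> Hb; apply/trivial_at_arrow; apply: NNPP => A; apply: N.
    by exists b; split; [exact: Hd | exists s].
  have /trivial_at_arrow [_ [A _]] : trivial_at s x d m.
    case: (classic (In m (tB _ _ d))) => [|Hm]; first exact: Hall.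
    exact: (proj2 (trivial_below _ _ d m (fun b Hb _ => Hall b Hb))).
  by rewrite A // mul_1l.
(* By minimality all elements of [T] are trivial along [x] below [b], so they fix the node of [x] at
   [b]. *)
have germ r : In r T -> exists k n, local_germ x b r k n.
  move=> Hr; have [d Hd] := HL _ Hr.
  have low c : In c (tB _ _ d) -> lt c b -> trivial_at r x d c.
    move=> Hc Hcb; apply/trivial_at_arrow; apply: NNPP => A.
    by apply: (Hmin c (Hd _ Hc) Hcb); exists r.
  exists (tk _ _ d b), (tn _ _ d b); split.
    move=> m Hm.
    have /trivial_at_arrow [_ [A _]] : trivial_at r x d m.
      case: (classic (In m (tB _ _ d))) => [Hin|Hin]; first exact: low.
      have low' c : In c (tB _ _ d) -> lt c m -> trivial_at r x d c.
        by move=> Hc Hcm; apply: low => //; exact: lt_trans Hm.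
      exact: (proj2 (trivial_below _ _ d m low')).
    by rewrite A // mul_1l.
  by have := t_arrow _ _ d b; rewrite (proj1 (trivial_below _ _ d b low)).
exists x, b; split=> //.
have [k [n Hg]] := germ _ Hs'; exists s', k, n; split=> //; split=> //.
apply: NNPP => N; apply: Bs'.
have <- : k = one by apply: NNPP => E; apply: N; left.
have <- : n = 0%Z by apply: NNPP => E; apply: N; right.
exact: (proj2 Hg).
Qed.

Lemma local_germ_mul x b s t k k' n n' : local_germ x b s k n -> local_germ x b t k' n' ->
  local_germ x b (mul s t) (mul k k') (n + n').
Proof.
move=> [As Gs] [At Gt].
have Gs' := arrow_agree _ _ _ _ _ _ _ At Gs.
split; last exact: arrow_mul Gt Gs'.
exact: (agree_trans _ _ _ _ As (proj1 (proj1 Gs (t x)) At)).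
Qed.

Lemma local_germ_inv x b s k n :
  local_germ x b s k n -> local_germ x b (inv s) (inv k) (- n).
Proof.
move=> [As Gs]; have G := arrow_agree _ _ _ _ _ _ _ (agree_sym _ _ _ As) (arrow_inv _ _ _ _ _ _ Gs).
split=> //; apply: (agree_trans _ _ (inv s (s x))); first by rewrite /= pfunK.
by apply: agree_sym; exact: (proj1 (proj1 G (s x)) As).
Qed.

Lemma local_germ_unique x b s k k' n n' :
  local_germ x b s k n -> local_germ x b s k' n' -> k = k' /\ n = n'.
Proof.
by move=> [_ A] [_ B]; case: (arrow_unique _ _ _ _ _ _ _ _ _ K_nontrivial A B).
Qed.

Lemma tame_locally_indicable (H : Sym -> Prop) :
  locally_indicable K -> (forall s, H s -> tame s) -> is_subgroup Sym H ->
  finitely_generated Sym H -> nontrivial_subset Sym H -> has_nontrivial_hom_to_Z Sym H.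
Proof.
move=> LI HT sgH [T HTgen] [x0 [Hx0 Nx0]].
have HinT s : In s T -> H s.
  by move=> Hs; apply/HTgen => P _; apply.
have NT : exists s, In s T /\ s <> one.
  apply: NNPP => N; apply: Nx0; apply: (proj1 (HTgen x0) Hx0 (fun s => s = one)).
    split=> //; split; first by move=> s t -> ->; rewrite mul_1l.
    by move=> s ->; rewrite inv_one.
  by move=> s Hs; apply: NNPP => E; apply: N; exists s.
have [x [b [Hgerm [s [k [n [Hs [Hg Hkn]]]]]]]] :=
  exists_first_germ T (fun s Hs => HT _ (HinT _ Hs)) NT.
have germ r : H r -> exists k n, local_germ x b r k n.
  move=> Hr; apply: (proj1 (HTgen r) Hr (fun r => exists k n, local_germ x b r k n)) => //.
  split; last split.
  - by exists one, 0%Z; split=> //; exact: arrow_fix.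
  - move=> r1 r2 [k1 [n1 G1]] [k2 [n2 G2]]; exists (mul k1 k2), (n1 + n2)%Z.
    exact: (local_germ_mul _ _ _ _ _ _ _ _ G1 G2).
  - by move=> r1 [k1 [n1 G1]]; exists (inv k1), (- n1)%Z; exact: local_germ_inv.
have [f Hf] : exists f : Sym -> K * Z, forall r, H r -> local_germ x b r (fst (f r)) (snd (f r)).
  apply: (choice_fun _ _ (fun r p => H r -> local_germ x b r (fst p) (snd p))) => r.
  case: (classic (H r)) => [/germ [k1 [n1 G]]|N].
    by exists (k1, n1).
  by exists (one, 0%Z).
have fM r1 r2 : H r1 -> H r2 -> fst (f (mul r1 r2)) = mul (fst (f r1)) (fst (f r2)) /\
    snd (f (mul r1 r2)) = (snd (f r1) + snd (f r2))%Z.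
  move=> H1 H2; apply: local_germ_unique (Hf _ _)
    (local_germ_mul _ _ _ _ _ _ _ _ (Hf _ H1) (Hf _ H2)).
  exact: (proj1 (proj2 sgH)).
have [Ek En] := local_germ_unique _ _ _ _ _ _ _ (Hf _ (HinT _ Hs)) Hg.
(* The germ map sends [s] to a nontrivial pair: the exponent is used if it is nonzero, and otherwise
   the letter together with the local indicability of [K]. *)
case: (classic (n = 0%Z)) => [E0|Nn].
  apply: (hom_to_locally_indicable _ _ _ (fun r => fst (f r)) LI sgH).
  - by exists T.
  - by move=> r1 r2 H1 H2; case: (fM _ _ H1 H2).
  - by exists s; split; [exact: HinT | rewrite Ek; case: Hkn].
exists (fun r => snd (f r)); split; first by move=> r1 r2 H1 H2; case: (fM _ _ H1 H2).
by exists s; split; [exact: HinT | rewrite En].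
Qed.
End Tracks.

(** * Transfer to subgroups, torsion and simplicity *)

Lemma subgroup_locally_indicable (G : Group) (P : G -> Prop) (sgP : is_subgroup G P) :
  (forall H : G -> Prop, (forall g, H g -> P g) -> is_subgroup G H ->
    finitely_generated G H -> nontrivial_subset G H -> has_nontrivial_hom_to_Z G H) ->
  locally_indicable (subgroup_group G P sgP).
Proof.
move=> LI H sgH [T HT] [x0 [Hx0 Nx0]].
have [H1 [HM HV]] := sgH.
pose H' g := exists p : P g, H (exist _ g p).
have H'val (t : subgroup_group G P sgP) : H t -> H' (proj1_sig t) by case: t => g p Ht; exists p.
have sgH' : is_subgroup G H'.
  split; first exact: H'val H1.
  split; first by move=> a b [p Ha] [q Hb]; exact: H'val (HM _ _ Ha Hb).
  by move=> a [p Ha]; exact: H'val (HV _ Ha).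
have HinT t : In t T -> H t by move=> Ht; apply/HT => Q _; apply.
have [|||f [fM [g [[p Hg] Ng]]]] := LI H' _ sgH'.
- by move=> g [].
- exists (map (@proj1_sig _ _) T) => g; split.
    move=> [p Hg] Q [Q1 [QM QV]] HQ.
    apply: (proj1 (HT _) Hg (fun t => Q (proj1_sig t))).
      by split=> //; split=> [a b|a]; [apply: QM | apply: QV].
    by move=> t Ht; apply: HQ; exact: in_map.
  move/(_ H' sgH'); apply=> _ /in_map_iff [t [<- Ht]].
  by apply: H'val; exact: HinT.
- exists (proj1_sig x0); split; first exact: H'val.
  by move=> E; apply: Nx0; apply: sub_ext.
exists (fun t => f (proj1_sig t)); split; last by exists (exist _ g p).
by move=> a b Ha Hb; apply: fM; exact: H'val.
Qed.

(** A nonzero map from the cyclic subgroup of [x] to [Z] is nonzero at [x], and [Z] has no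
    torsion. *)
Lemma locally_indicable_torsion_free (K : Group) (x : K) :
  locally_indicable K -> x <> one -> forall n, powg x (S n) <> one.
Proof.
move=> LI Nx.
pose H := generated K (x :: nil).
have Hx : H x by move=> P _; apply; left.
have sgH : is_subgroup K H.
  split; first by move=> P [].
  split; first by move=> a b Ha Hb P sgP HP; apply: (proj1 (proj2 sgP)); [apply: Ha | apply: Hb].
  by move=> a Ha P sgP HP; apply: (proj2 (proj2 sgP)); apply: Ha.
have [H1 [HM HV]] := sgH.
have [||f [fM [y [Hy Ny]]]] := LI H sgH.
- by exists (x :: nil).
- by exists x.
have f1 : f one = 0%Z by have := fM _ _ H1 H1; rewrite mul_1l; lia.
have Nfx : f x <> 0%Z.
  move=> E; apply: Ny; apply: (proj2 (Hy (fun a => H a /\ f a = 0%Z) _ _)).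
    split=> //; split.
      by move=> a b [Ha Ea] [Hb Eb]; split; [exact: HM | rewrite fM // Ea Eb].
    move=> a [Ha Ea]; split; first exact: HV.
    by have := fM _ _ Ha (HV _ Ha); rewrite mul_Vr f1 Ea; lia.
  by move=> a [<-|[]].
have Hp n : f (powg x n) = (Z.of_nat n * f x)%Z.
  elim: n => [//|n IH].
  rewrite [powg _ _]/= fM // ?IH; first lia.
  exact: (subgroup_pow _ _ _ _ sgH Hx).
by move=> n E; have := Hp (S n); rewrite E f1; nia.
Qed.

(** The right-hand side is a product of conjugates of [a] and [inv a], so it lies in every normal
    subgroup containing [a]. *)
Lemma conj_comm_simple (G : Group) :
  (exists x : G, x <> one) ->
  (forall a b : G, a <> one -> exists g1 g2 h,
    b = conjg (inv h) (commg (commg (conjg h g1) a) (conjg h g2))) ->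
  simple_group G.
Proof.
move=> NG HG; split=> // N [[N1 [NM NV]] Nconj].
case: (classic (forall x, N x -> x = one)) => [|H]; [by left | right=> b].
have [a [Ha Na]] : exists a, N a /\ a <> one.
  by apply: NNPP => E; apply: H => x Hx; apply: NNPP => Nx; apply: E; exists x.
have [g1 [g2 [h ->]]] := HG a b Na; apply: (Nconj (inv h)).
have NC : N (commg (conjg h g1) a).
  have -> : commg (conjg h g1) a = mul (conjg (conjg h g1) a) (inv a).
    by rewrite {1}/commg {2}/conjg !mul_assoc.
  by apply: NM; [exact: Nconj | exact: NV].
by rewrite comm_conj_inv; apply: NM => //; apply: Nconj; exact: NV.
Qed.

Lemma subgroup_simple (G : Group) (P : G -> Prop) (sgP : is_subgroup G P) :
  (exists x, P x /\ x <> one) ->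
  (forall a b, P a -> P b -> a <> one -> exists g1 g2 h, P g1 /\ P g2 /\ P h /\
    b = conjg (inv h) (commg (commg (conjg h g1) a) (conjg h g2))) ->
  simple_group (subgroup_group G P sgP).
Proof.
move=> [x [Px Nx]] HP; apply: conj_comm_simple.
  by exists (exist P x Px) => /(f_equal (@proj1_sig _ _)).
move=> [a Pa] [b Pb] Na.
have [|g1 [g2 [h [P1 [P2 [Ph E]]]]]] := HP a b Pa Pb.
  by move=> E; apply: Na; apply: sub_ext.
exists (exist P g1 P1), (exist P g2 P2), (exist P h Ph).
by apply: sub_ext.
Qed.

(** * Strong boundedness *)

Section Boundedness.
Local Open Scope R_scope.

(** If an orbit were unbounded, one could choose [g n] moving [x] by more than [n (2 n + 1)]; as
    words in [psi] and [s], these move it by at most a constant times [2 n + 1]. *)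
Lemma seq_words_strongly_bounded (G : Group) :
  (forall g : nat -> G, exists psi s, forall n,
    g n = commg (conjg (inv (powg s (2 * n + 1))) psi) psi) ->
  strongly_bounded G.
Proof.
move=> HG X d act [d0 [dE [dC dT]]] [act1 [actM actI]] x.
(* Displacement of [x], a symmetric subadditive length function on [G]. *)
pose L g := d x (act g x).
have L1 : L one = 0 by rewrite /L act1; apply/dE.
have LM g h : L (mul g h) <= L g + L h.
  rewrite /L actM; have := dT x (act g x) (act g (act h x)).
  by rewrite actI.
have LV g : L (inv g) = L g.
  by rewrite /L -(actI g) -actM mul_Vr act1 dC.
have LP g n : L (powg g n) <= INR n * L g.
  elim: n => [|n IH]; first by rewrite L1 /=; lra.
  rewrite S_INR; have := LM g (powg g n); rewrite [powg g (S n)]/=; lra.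
have LC g h : L (conjg g h) <= 2 * L g + L h.
  by have := LM (mul g h) (inv g); have := LM g h; rewrite LV /conjg; lra.
apply: NNPP => N.
have big M : exists g, M < L g.
  by apply: NNPP => E; apply: N; exists M => g; apply: Rnot_lt_le => Hg; apply: E; exists g.
have [g Hg] := choice_fun _ _ _ (fun n : nat => big (INR n * INR (2 * n + 1))).
have [psi [s Hs]] := HG g.
have [n Hn] := INR_unbounded (4 * L s + 4 * L psi).
have := Hg n; rewrite Hs.
set c := conjg _ psi.
have Hc : L c <= 2 * (INR (2 * n + 1) * L s) + L psi.
  have := LC (inv (powg s (2 * n + 1))) psi; rewrite LV -/c.
  by have := LP s (2 * n + 1)%nat; lra.
have Hcomm : L (commg c psi) <= 2 * L c + 2 * L psi.
  rewrite /commg; have := LM (mul c psi) (mul (inv c) (inv psi)).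
  by have := LM c psi; have := LM (inv c) (inv psi); rewrite !LV; lra.
have Hpsi : 0 <= L psi by exact: d0.
have Hs0 : 0 <= L s by exact: d0.
have He : 1 <= INR (2 * n + 1) by rewrite -INR_1; apply: le_INR; lia.
by nra.
Qed.
End Boundedness.

Lemma subgroup_strongly_bounded (G : Group) (P : G -> Prop) (sgP : is_subgroup G P) :
  (forall g : nat -> G, (forall n, P (g n)) -> exists psi s, P psi /\ P s /\ forall n,
    g n = commg (conjg (inv (powg s (2 * n + 1))) psi) psi) ->
  strongly_bounded (subgroup_group G P sgP).
Proof.
move=> HP; apply: seq_words_strongly_bounded => g.
have [psi [s [Ppsi [Ps E]]]] := HP _ (fun n => proj2_sig (g n)).
pose s' : subgroup_group G P sgP := exist P s Ps.
have Epow m : proj1_sig (powg s' m) = powg s m by elim: m => [//|m /= ->].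
exists (exist P psi Ppsi), s' => n; apply: sub_ext.
by rewrite E -Epow.
Qed.

(** * The Cantor-Schröder-Bernstein theorem *)

Lemma equipotent_of_injections (A B : Type) (f : A -> B) (g : B -> A) :
  (forall a a', f a = f a' -> a = a') -> (forall b b', g b = g b' -> b = b') ->
  equipotent A B.
Proof.
move=> fI gI.
(* The least set containing the complement of the image of [g] and closed under [g] after [f]. The
   bijection is [f] on it and the inverse of [g] elsewhere. *)
pose C a := forall P : A -> Prop, (forall a, (forall b, g b <> a) -> P a) ->
  (forall a, P a -> P (g (f a))) -> P a.
have C0 a : (forall b, g b <> a) -> C a by move=> H P P0 _; exact: P0.
have C1 a : C a -> C (g (f a)) by move=> H P P0 P1; apply: (P1); apply: H.
have C2 a : C (g (f a)) -> C a.
  move=> H; have : C (g (f a)) /\ forall a', g (f a') = g (f a) -> C a'.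
    apply: (H (fun b => C b /\ forall a', g (f a') = b -> C a')).
      by move=> b Hb; split; [exact: C0 | move=> a' /Hb].
    by move=> b [Cb _]; split; [exact: C1 | move=> a' /gI /fI ->].
  by case=> _; apply.
have [h Hh] : exists h : A -> B, forall a, (C a -> h a = f a) /\ (~ C a -> g (h a) = a).
  apply: (choice_fun _ _ (fun a b => (C a -> b = f a) /\ (~ C a -> g b = a))) => a.
  case: (classic (C a)) => Ca; first by exists (f a).
  have [b Hb] : exists b, g b = a.
    by apply: NNPP => N; apply: Ca; apply: C0 => b Hb; apply: N; exists b.
  by exists b.
have hI a a' : h a = h a' -> a = a'.
  case: (classic (C a)) => Ca; case: (classic (C a')) => Ca'.
  - by rewrite (proj1 (Hh a)) // (proj1 (Hh a')) // => /fI.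
  - rewrite (proj1 (Hh a)) // => E; case: (Ca').
    by rewrite -(proj2 (Hh a') Ca') -E; exact: C1.
  - rewrite (proj1 (Hh a')) // => E; case: (Ca).
    by rewrite -(proj2 (Hh a) Ca) E; exact: C1.
  - by move=> E; rewrite -(proj2 (Hh a) Ca) E (proj2 (Hh a') Ca').
have [k Hk] : exists k : B -> A, forall b, h (k b) = b.
  apply: (choice_fun _ _ (fun b a => h a = b)) => b.
  case: (classic (C (g b))) => Cb; last by exists (g b); apply: gI; exact: (proj2 (Hh _)).
  have [a Ha] : exists a, g (f a) = g b.
    apply: NNPP => N.
    have : C (g b) /\ g b <> g b; last by case.
    apply: (Cb (fun a => C a /\ a <> g b)).
      by move=> a Ha; split; [exact: C0 | move=> E; apply: (Ha b)].
    by move=> a [Ca _]; split; [exact: C1 | move=> E; apply: N; exists a].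
  exists a; rewrite (proj1 (Hh a)); first exact: gI.
  by apply: C2; rewrite Ha.
by exists h, k; split=> // a; apply: hI.
Qed.

(** * Closure under operations of countable arity *)

(** Every node takes a sequence of arguments; operations of smaller arity read only its first
    entries. *)
Inductive term (X : Type) : Type :=
| Leaf (x : X)
| Node (o : nat) (a : nat -> term X).

Fixpoint eval (G X : Type) (iota : X -> G) (F : nat -> (nat -> G) -> G) (t : term X) : G :=
  match t with
  | Leaf x => iota x
  | Node o a => F o (fun i => eval G X iota F (a i))
  end.

(** * Coding terms by sequences in [K] *)

Section Coding.
Variables (K : Group) (z : K).
Hypothesis z_pow : forall n, powg z (S n) <> one.

(* A term is determined by the labels at the end of its paths. *)
Fixpoint label (t : term (nat -> K)) (p : list nat) : nat -> K :=
  match t, p with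
  | Leaf u, nil => fun j => match j with O => one | S j => u j end
  | Leaf _, _ => fun _ => one
  | Node o _, nil => fun j => match j with O => z | S _ => powg z o end
  | Node _ a, i :: p => label (a i) p
  end.

(** At the empty path, entry [0] separates leaves, marked [one], from nodes, marked [z]. The later
    entries give the sequence at a leaf and the operation, as a power of [z], at a node; longer
    paths reach the arguments. *)
Lemma label_inj t t' : (forall p, label t p = label t' p) -> t = t'.
Proof.
have Nz : z <> one by move=> E; apply: (z_pow 0); rewrite /= mul_1r.
elim: t t' => [u|o a IH] [u'|o' a'] H.
- have E j : u j = u' j by have := f_equal (fun w => w (S j)) (H nil).
  by congr Leaf; apply: functional_extensionality.
- by have := f_equal (fun w => w O) (H nil) => /= E; case: Nz.
- by have := f_equal (fun w => w O) (H nil) => /= E; case: Nz.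
- have Eo : o = o'.
    by apply: (pow_inj _ _ z_pow); have := f_equal (fun w => w 1) (H nil).
  rewrite Eo; congr Node; apply: functional_extensionality => i.
  by apply: IH => p; exact: (H (i :: p)).
Qed.

Fixpoint encode (p : list nat) : nat :=
  match p with nil => O | i :: p => S (Cantor.to_nat (i, encode p)) end.

Lemma encode_inj p p' : encode p = encode p' -> p = p'.
Proof.
elim: p p' => [|i p IH] [|i' p'] // /eq_add_S /(f_equal Cantor.of_nat).
by rewrite !Cantor.cancel_of_to => -[-> /IH ->].
Qed.

(** Using [epsilon] avoids writing a decoder: by [encode_inj] an index determines the pair that it
    codes. *)
Definition flatten (w : list nat -> nat -> K) (i : nat) : K :=
  epsilon (inhabits one) (fun k => exists p j, i = Cantor.to_nat (encode p, j) /\ k = w p j).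

Lemma flattenE w p j : flatten w (Cantor.to_nat (encode p, j)) = w p j.
Proof.
rewrite /flatten.
have [|p' [j' [E ->]]] := epsilon_spec (inhabits (one : K)) (fun k => exists p' j',
  Cantor.to_nat (encode p, j) = Cantor.to_nat (encode p', j') /\ k = w p' j').
  by exists (w p j), p, j.
move/(f_equal Cantor.of_nat): E; rewrite !Cantor.cancel_of_to => -[/encode_inj -> ->] //.
Qed.

Lemma term_code_inj t t' : flatten (label t) = flatten (label t') -> t = t'.
Proof.
move=> E; apply: label_inj => p; apply: functional_extensionality => j.
by rewrite -!flattenE E.
Qed.
End Coding.

(** * Assembly of the group *)

(* |G| = |K|^aleph_0 is expressed as |G| = |nat -> K|. *)
Theorem theoremC (K : Group) :
  locally_indicable K -> (exists x : K, x <> one) ->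
  exists G : Group,
    embeds K G /\ simple_group G /\ locally_indicable G /\
    strongly_bounded G /\ equipotent G (nat -> K).
Proof.
move=> LI [z Nz].
have z_pow := locally_indicable_torsion_free K z LI Nz.
pose Sym := perm_group (omega K).
have sgT := tame_subgroup K; have [T1 _] := sgT.
have [iota [Tiota [iotaM iotaI]]] := exists_seq_embedding K z z_pow.
have [c1 [c2 [c3 Hc]]] := tame_conj_comm_skolem K z z_pow.
have [e1 [e2 He]] := tame_seq_words_skolem K z z_pow.
(* The group [P] is the closure of the image of [iota] under the group operations and the
   Skolem functions [c1], [c2], [c3], [e1], [e2]. *)
pose F (o : nat) (a : nat -> Sym) : Sym := match o with
  | 0 => mul (a 0) (a 1)
  | 1 => inv (a 0)
  | 2 => c1 (a 0) (a 1)
  | 3 => c2 (a 0) (a 1)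
  | 4 => c3 (a 0) (a 1)
  | 5 => e1 a
  | _ => e2 a
  end.
pose P (g : Sym) := exists t, eval Sym (nat -> K) iota F t = g.
(* By induction on terms: products and inverses preserve tameness, and the Skolem functions have
   tame values by construction. *)
have PT g : P g -> tame K g.
  have [_ [TM TV]] := sgT.
  case=> t <-; elim: t => [u|o a IH]; first exact: Tiota.
  pose w i := eval Sym _ iota F (a i); have {}IH : forall n, tame K (w n) := IH.
  change (tame K (F o w)); move: w IH => w Tw.
  have [U1 [U2 [U3 _]]] := Hc (w 0) (w 1).
  have [V1 [V2 _]] := He w.
  by case: o => [|[|[|[|[|[|o]]]]]] //; [exact: TM (Tw 0) (Tw 1) | exact: TV (Tw 0)].
have PF o a : (forall n, P (a n)) -> P (F o a).
  move=> /choice_fun [t Ht]; exists (Node _ o t) => /=; congr F.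
  exact: functional_extensionality.
have PF2 o a b : P a -> P b -> P (F o (fun n => match n with O => a | _ => b end)).
  by move=> Pa Pb; apply: PF => -[].
have Piota u : P (iota u) by exists (Leaf _ u).
have iota1 : iota (fun _ => one) = one.
  apply: (mul_eq_self _ _ (iota (fun _ => one))); rewrite -iotaM.
  by congr iota; apply: functional_extensionality => n; rewrite mul_1l.
have P1 : P one by rewrite -iota1; exact: Piota.
have sgP : is_subgroup Sym P.
  split=> //; split; first by move=> a b; exact: (PF2 0).
  by move=> a Pa; exact: (PF2 1 _ _ Pa Pa).
exists (subgroup_group Sym P sgP).
split; [|split; [|split; [|split]]].
(* [K] embeds as the constant sequences. *)
- exists (fun k => exist P (iota (fun _ => k)) (Piota _)); split.
    by move=> x y; apply: sub_ext; exact: (iotaM (fun _ => x) (fun _ => y)).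
  by move=> x y /(f_equal (@proj1_sig _ _)) /iotaI /(f_equal (fun u => u O)).
- apply: subgroup_simple.
    exists (iota (fun _ => z)); split=> // E; apply: Nz.
    by move: E; rewrite -[RHS]iota1 => /iotaI /(f_equal (fun u => u O)).
  move=> a b Pa Pb Na; exists (c1 a b), (c2 a b), (c3 a b).
  split; [exact: (PF2 2 _ _ Pa Pb) | split; [exact: (PF2 3 _ _ Pa Pb) | split]].
    exact: (PF2 4 _ _ Pa Pb).
  by have [_ [_ [_ E]]] := Hc a b; apply: E => //; exact: PT.
- apply: subgroup_locally_indicable => H HP sgH.
  apply: (tame_locally_indicable K z z_pow H LI _ sgH) => s /HP; exact: PT.
- apply: subgroup_strongly_bounded => g Pg; exists (e1 g), (e2 g).
  split; [exact: (PF 5 _ Pg) | split; [exact: (PF 6 _ Pg) |]].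
  by have [_ [_ E]] := He g; apply: E => n; exact: PT.
(* Coding a term chosen for each element injects the group into [nat -> K]; [iota] gives the
   injection in the other direction. *)
- have [code Hcode] := choice_fun _ _ _ (fun x : subgroup_group Sym P sgP => proj2_sig x).
  apply: (equipotent_of_injections _ _ (fun x => flatten K (label K z (code x)))
    (fun u => exist P (iota u) (Piota u))).
    move=> x y /(term_code_inj K z z_pow) E; apply: sub_ext.
    by rewrite -(Hcode x) E Hcode.
  by move=> u v /(f_equal (@proj1_sig _ _)) /iotaI.
Qed.
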